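(* Let $(\mathfrak{X}_n)_{n\geq1}$ and $\mathfrak{X}_\infty$ be random compact metric measure spaces (random variables in $\mathbb{M}_{\mathrm{GHP}}$). Let $(a_n)_{n\ge1}$, $(b_n)_{n\ge1}$ be tame sequences, and let $(N_n)_{n\geq1}$ be random positive integers independent of $(\mathfrak{X}_n)_{n\geq1}$ and $\mathfrak{X}_\infty$. Assume: (1) $(a_n,b_n)\cdot\mathfrak{X}_{N_n}\to\mathfrak{X}_\infty$ in distribution for the GHP topology; (2) $N_n/n\to1$ in probability; (3) with $\mathbb{P}_n$ the law of $\mathfrak{X}_n$, one has $\mathbb{P}_1\unlhd_{\mathrm{st}}\mathbb{P}_2\unlhd_{\mathrm{st}}\mathbb{P}_3\unlhd_{\mathrm{st}}\cdots$. Then $(a_n,b_n)\cdot\mathfrak{X}_n\to\mathfrak{X}_\infty$ in distribution for the GHP topology.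
   Context: $\mathbb{M}_{\mathrm{GHP}}$ is the Polish space of measure-preserving isometry classes $[X,d,\mu]$ of compact metric spaces with a finite Borel measure, with the Gromov--Hausdorff--Prokhorov (GHP) metric (infimum over common isometric embeddings into a metric space of Hausdorff distance of the images plus Prokhorov distance of the pushed-forward measures). For $a,b>0$, $(a,b)\cdot[X,d,\mu]=[X,a\cdot d,b\cdot\mu]$. A positive sequence $(x_n)$ is tame if $x_{n+k_n}/x_n\to1$ whenever $k_n=o(n)$. Write $\mathcal{X}\unlhd\mathcal{X}'$ (for $\mathcal{X}=[X,d,\mu]$, $\mathcal{X}'=[X',d',\mu']$) if there is a surjective 1-Lipschitz map $\phi:X'\to X$ with $\mu(A)\le\mu'(\phi^{-1}(A))$ for all Borel $A\subset X$. For Borel probability measures $\mathbb{P},\mathbb{P}'$ on $\mathbb{M}_{\mathrm{GHP}}$, $\mathbb{P}\unlhd_{\mathrm{st}}\mathbb{P}'$ means $\mathbb{P}(A)\le\mathbb{P}'(A)$ for every Borel set $A$ that is $\unlhd$-increasing ($\mathcal{X}\in A$, $\mathcal{X}\unlhd\mathcal{X}'$ imply $\mathcal{X}'\in A$). *)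

(* Defs.v *)
From Stdlib Require List.
From HB Require Import structures.
From mathcomp Require Import all_boot all_order all_algebra.
From mathcomp Require Import all_classical all_reals all_analysis.
Set Implicit Arguments. Unset Strict Implicit. Unset Printing Implicit Defensive.
Import Order.TTheory GRing.Theory Num.Theory.
Import numFieldNormedType.Exports.
Local Open Scope classical_set_scope.
Local Open Scope ring_scope.

Definition is_metric (R : realType) (T : Type) (d : T -> T -> R) : Prop :=
  [/\ forall x y, 0 <= d x y, forall x y, d x y = 0 <-> x = y,
      forall x y, d x y = d y x & forall x y z, d x z <= d x y + d y z].

Definition dopen (R : realType) (T : Type) (d : T -> T -> R) (U : set T) : Prop :=
  forall x, U x -> exists2 e : R, 0 < e & forall y, d x y < e -> U y.

Definition dclosed (R : realType) (T : Type) (d : T -> T -> R) (F : set T) : Prop :=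
  dopen d (~` F).

Definition dcompact (R : realType) (T : Type) (d : T -> T -> R) : Prop :=
  forall (I : Type) (U : I -> set T), (forall i, dopen d (U i)) ->
    (forall x, exists i, U i x) ->
    exists s : list I, forall x, exists i, List.In i s /\ U i x.

Definition nbhd (R : realType) (T : Type) (d : T -> T -> R) (A : set T) (e : R) : set T :=
  [set z | exists2 y, A y & d z y < e].

Definition isometric (R : realType) (T Z : Type) (dT : T -> T -> R) (dZ : Z -> Z -> R)
  (f : T -> Z) : Prop := forall x y, dZ (f x) (f y) = dT x y.

Definition hausdorff (R : realType) (Z : Type) (d : Z -> Z -> R) (A B : set Z) : R :=
  inf [set e : R | 0 < e /\ A `<=` nbhd d B e /\ B `<=` nbhd d A e].

Definition prokhorov (R : realType) (Z : Type) (d : Z -> Z -> R)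
  (nu nu' : set Z -> \bar R) : R :=
  inf [set e : R | 0 < e /\ forall F, dclosed d F ->
        (nu F <= nu' (nbhd d F e) + e%:E)%E /\ (nu' F <= nu (nbhd d F e) + e%:E)%E].

Definition dborel (R : realType) (T : Type) (d : T -> T -> R) : set (set T) :=
  <<s dopen d >>.

(* finite (real-valued) Borel measures w.r.t. d; values off Borel sets are irrelevant *)
Definition is_finite_borel_measure (R : realType) (T : Type) (d : T -> T -> R)
  (mu : set T -> R) : Prop :=
  [/\ mu set0 = 0, forall A, dborel d A -> 0 <= mu A &
      forall F : nat -> set T, (forall n, dborel d (F n)) -> trivIset setT F ->
        (fun n => \sum_(i < n) mu (F i) : R) @ \oo --> (mu (\bigcup_n F n) : R)].

Record mmspace (R : realType) := MMSpace {
  mm_pt : Type;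
  mm_d : mm_pt -> mm_pt -> R;
  mm_mu : set mm_pt -> R;
  mm_metric : is_metric mm_d;
  mm_measure : is_finite_borel_measure mm_d mm_mu;
  mm_compact : dcompact mm_d;
  mm_inhabited : inhabited mm_pt }.
Arguments mm_pt {R} m.
Arguments mm_d {R} m _ _.
Arguments mm_mu {R} m _.
Arguments mm_metric {R} m.
Arguments mm_measure {R} m.
Arguments mm_compact {R} m.
Arguments mm_inhabited {R} m.

Definition dGHP (R : realType) (X Y : mmspace R) : R :=
  inf [set r : R | exists (Z : Type) (dZ : Z -> Z -> R)
        (f : mm_pt X -> Z) (g : mm_pt Y -> Z),
        [/\ is_metric dZ, isometric (@mm_d R X) dZ f, isometric (@mm_d R Y) dZ g &
            r = hausdorff dZ (range f) (range g)
                + prokhorov dZ (fun A => (mm_mu X (f @^-1` A))%:E)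
                               (fun A => (mm_mu Y (g @^-1` A))%:E)]].

Definition GHPopen (R : realType) (U : set (mmspace R)) : Prop :=
  forall X, U X -> exists2 e : R, 0 < e & forall Y, dGHP X Y < e -> U Y.

Definition GHPborel (R : realType) : set (set (mmspace R)) := <<s @GHPopen R >>.

Lemma scale_metric (R : realType) (T : Type) (d : T -> T -> R) (a : R) :
  0 < a -> is_metric d -> is_metric (fun x y => a * d x y).
Proof.
move=> a0 [d0 dE dC dT]; split.
- by move=> x y; rewrite mulr_ge0 // ltW.
- move=> x y; split; last by move=> ->; rewrite (proj2 (dE y y)) // mulr0.
  by move/eqP; rewrite mulf_eq0 gt_eqF //= => /eqP/dE.
- by move=> x y; rewrite dC.
- by move=> x y z; rewrite -mulrDr ler_wpM2l // ltW.
Qed.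

Lemma dopen_scale (R : realType) (T : Type) (d : T -> T -> R) (a : R) :
  0 < a -> dopen (fun x y => a * d x y) = dopen d.
Proof.
move=> a0; apply/funext => U; apply/propext; split => + x Ux.
- move=> /(_ x Ux) [e e0 He]; exists (e / a); first by rewrite divr_gt0.
  by move=> y dy; apply: He; rewrite -ltr_pdivlMl // mulrC.
- move=> /(_ x Ux) [e e0 He]; exists (a * e); first by rewrite mulr_gt0.
  by move=> y dy; apply: He; rewrite -(ltr_pM2l a0).
Qed.

Lemma dcompact_scale (R : realType) (T : Type) (d : T -> T -> R) (a : R) :
  0 < a -> dcompact d -> dcompact (fun x y => a * d x y).
Proof. by move=> a0; rewrite /dcompact dopen_scale. Qed.

Lemma dborel_scale (R : realType) (T : Type) (d : T -> T -> R) (a : R) :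
  0 < a -> dborel (fun x y => a * d x y) = dborel d.
Proof. by move=> a0; rewrite /dborel dopen_scale. Qed.

Lemma measure_scale (R : realType) (T : Type) (d : T -> T -> R) (mu : set T -> R)
  (a b : R) : 0 < a -> 0 < b -> is_finite_borel_measure d mu ->
  is_finite_borel_measure (fun x y => a * d x y) (fun A => b * mu A).
Proof.
move=> a0 b0 [m0 mge0 madd]; rewrite /is_finite_borel_measure dborel_scale //; split.
- by rewrite m0 mulr0.
- by move=> A /mge0 h; rewrite mulr_ge0 // ltW.
- move=> F FB tF.
  rewrite (_ : (fun n => _) = (fun n => b * \sum_(i < n) mu (F i))).
    exact: (cvgMl_tmp (a := b) (madd F FB tF)).
  by apply/funext => n; rewrite mulr_sumr.
Qed.

Definition mmscale (R : realType) (a b : {posnum R}) (X : mmspace R) : mmspace R :=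
  @MMSpace R (mm_pt X) (fun x y => a%:num * mm_d X x y)
    (fun A => b%:num * mm_mu X A)
    (scale_metric (gt0 a) (mm_metric X))
    (measure_scale (gt0 a) (gt0 b) (mm_measure X))
    (dcompact_scale (gt0 a) (mm_compact X))
    (mm_inhabited X).

Definition mm_le (R : realType) (X X' : mmspace R) : Prop :=
  exists phi : mm_pt X' -> mm_pt X,
    [/\ forall y, exists x, phi x = y,
        forall x y, mm_d X (phi x) (phi y) <= mm_d X' x y &
        forall A, dborel (@mm_d R X) A -> mm_mu X A <= mm_mu X' (phi @^-1` A)].

Definition mm_increasing (R : realType) (A : set (mmspace R)) : Prop :=
  forall X X', A X -> mm_le X X' -> A X'.

Definition law (R : realType) (dO : measure_display) (Omega : measurableType dO)
  (P : probability Omega R) (X : Omega -> mmspace R) : set (mmspace R) -> \bar R :=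
  fun A => P (X @^-1` A).

Definition stoch_le (R : realType) (dO : measure_display) (Omega : measurableType dO)
  (P : probability Omega R) (X X' : Omega -> mmspace R) : Prop :=
  forall A, GHPborel A -> mm_increasing A -> (law P X A <= law P X' A)%E.

Definition GHP_random (R : realType) (dO : measure_display) (Omega : measurableType dO)
  (X : Omega -> mmspace R) : Prop :=
  forall B, GHPborel B -> measurable (X @^-1` B).

Definition GHP_bounded (R : realType) (f : mmspace R -> R) : Prop :=
  exists M : R, forall X, `|f X| <= M.

Definition GHP_continuous (R : realType) (f : mmspace R -> R) : Prop :=
  forall X (e : R), 0 < e -> exists2 delta : R, 0 < delta &
    forall Y, dGHP X Y < delta -> `|f X - f Y| < e.

Definition conv_distr (R : realType) (dO : measure_display) (Omega : measurableType dO)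
  (P : probability Omega R) (Y : nat -> Omega -> mmspace R) (Yinf : Omega -> mmspace R)
  : Prop :=
  forall f : mmspace R -> R, GHP_bounded f -> GHP_continuous f ->
    (\int[P]_w (f (Y n w))%:E)%E @[n --> \oo] --> (\int[P]_w (f (Yinf w))%:E)%E.

Definition tame (R : realType) (x : nat -> R) : Prop :=
  forall k : nat -> nat, (fun n => (k n)%:R / n%:R : R) @ \oo --> (0 : R) ->
    (fun n => x (n + k n)%N / x n) @ \oo --> (1 : R).

Definition indep_sigma (R : realType) (dO : measure_display) (Omega : measurableType dO)
  (P : probability Omega R) (S1 S2 : set (set Omega)) : Prop :=
  forall A B, S1 A -> S2 B -> P (A `&` B) = (P A * P B)%E.

Definition sigma_nat (dO : measure_display) (Omega : measurableType dO)
  (N : nat -> Omega -> nat) : set (set Omega) :=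
  <<s [set E | exists n (B : set nat), (1 <= n)%N /\ E = N n @^-1` B] >>.

Definition sigma_GHP (R : realType) (dO : measure_display) (Omega : measurableType dO)
  (X : nat -> Omega -> mmspace R) (Xinf : Omega -> mmspace R) : set (set Omega) :=
  <<s [set E | (exists k B, [/\ (1 <= k)%N, GHPborel B & E = X k @^-1` B])
               \/ (exists B, GHPborel B /\ E = Xinf @^-1` B)] >>.

(* Main.v *)
(* Idea. Weaken [mm_le] to a relation [dom r X Y], "Y lies below X up to an error r",
   which is transitive with additive errors. Two spaces that dominate each other up
   to a small error are GHP-close (a compact space has no almost expanding self-map
   other than almost isometries), and conversely, so the bumps built from the
   functions [domq _ W] and [domq W _], which are monotone for [mm_le], generate
   the GHP topology.
   For a bounded continuous increasing [p], tameness and stochastic monotonicity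
   squeeze the mean of [p] at [X n] between its means at [X (N m)] for [m] slightly
   below and slightly above [n]. Products of nonnegative increasing functions are
   increasing, so convergence extends to the algebra they span, then to open sets by
   countable covers with bumps; neither tightness nor a coupling is needed. *)
Require Import Defs.
From HB Require Import structures.
From mathcomp Require Import all_boot all_order all_algebra.
From mathcomp Require Import all_classical all_reals all_analysis.
From mathcomp Require Import measurable_realfun.
From mathcomp Require Import zify ring lra.
Set Implicit Arguments. Unset Strict Implicit. Unset Printing Implicit Defensive.
Import Order.TTheory GRing.Theory Num.Theory.
Import numFieldNormedType.Exports.
Local Open Scope classical_set_scope.
Local Open Scope ring_scope.

(** * Borel sets and finite measures *)

(** The hypothesis on the laws sees only increasing sets, whereas weak convergence is tested against
    all continuous functions. The gap is closed by localising with two increasing functions: [u] is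
    1 on spaces that nearly dominate a centre, [l] is 0 on spaces nearly dominated by it, and
    [u (1 - l)] is a bump. The order [mm_le] is too rigid for this, since it need not relate spaces
    that are merely GHP-close; hence the errors in both distances and masses. A relation replaces
    the surjection also because points selected by choice give maps with no measurability. In the
    squeeze, the auxiliary indices are [n - k] and [n + k] with [k] about [t n / 2]: [t] is small
    enough for tameness to keep the scaling ratios below a factor [l] close to 1, yet fixed, so that
    [N m] lies on the required side of [n] with probability tending to 1. Open sets yield only
    one-sided bounds; applying these to a function and to its complement to 1 gives the limit. *)

Lemma dborel_open (R : realType) (T : Type) (d : T -> T -> R) (U : set T) :
  dopen d U -> dborel d U.
Proof. exact: sub_gen_smallest. Qed.

Lemma dborelC (R : realType) (T : Type) (d : T -> T -> R) (A : set T) :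
  dborel d A -> dborel d (~` A).
Proof.
have [_ hC _] := smallest_sigma_algebra [set: T] (dopen d).
by move=> /hC; rewrite setTD.
Qed.

Lemma dborel_bigcup (R : realType) (T : Type) (d : T -> T -> R) (F : nat -> set T) :
  (forall n, dborel d (F n)) -> dborel d (\bigcup_n F n).
Proof. by have [_ _ h] := smallest_sigma_algebra [set: T] (dopen d); exact: h. Qed.

Lemma dborel0 (R : realType) (T : Type) (d : T -> T -> R) : dborel d set0.
Proof. by have [h _ _] := smallest_sigma_algebra [set: T] (dopen d). Qed.

Lemma dborelT (R : realType) (T : Type) (d : T -> T -> R) : dborel d setT.
Proof. by rewrite -setC0; apply: dborelC; apply: dborel0. Qed.

Lemma dborelU (R : realType) (T : Type) (d : T -> T -> R) (A B : set T) :
  dborel d A -> dborel d B -> dborel d (A `|` B).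
Proof.
move=> hA hB; rewrite -bigcup2E; apply: dborel_bigcup => -[|[|n]] //=.
exact: dborel0.
Qed.

Lemma dborelD (R : realType) (T : Type) (d : T -> T -> R) (A B : set T) :
  dborel d A -> dborel d B -> dborel d (A `\` B).
Proof.
move=> hA hB; rewrite setDE -[A]setCK -setCU; apply: dborelC; apply: dborelU => //.
exact: dborelC.
Qed.

Lemma dclosed_borel (R : realType) (T : Type) (d : T -> T -> R) (F : set T) :
  dclosed d F -> dborel d F.
Proof. by move=> /dborel_open/dborelC; rewrite setCK. Qed.

Lemma dborel_preimage (R : realType) (S T : Type) (dS : S -> S -> R)
  (dT : T -> T -> R) (f : S -> T) (A : set T) :
  (forall x y, dT (f x) (f y) <= dS x y) -> dborel dT A -> dborel dS (f @^-1` A).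
Proof.
move=> f1 hA.
suff : dborel dT `<=` [set B | dborel dS (f @^-1` B)] by apply.
apply: smallest_sub => [|U oU].
  split => /=.
  - by rewrite preimage_set0; exact: dborel0.
  - by move=> B hB; rewrite setTD preimage_setC; exact: dborelC.
  - by move=> F hF; rewrite preimage_bigcup; exact: dborel_bigcup.
apply: dborel_open => x /oU[e e0 he]; exists e => // y dxy.
by apply: he; exact: le_lt_trans dxy.
Qed.

Lemma mm_mu_ge0 (R : realType) (X : mmspace R) (A : set (mm_pt X)) :
  dborel (mm_d X) A -> 0 <= mm_mu X A.
Proof. by have [_ h _] := mm_measure X; exact: h. Qed.

Lemma mm_muU (R : realType) (X : mmspace R) (A B : set (mm_pt X)) :
  dborel (mm_d X) A -> dborel (mm_d X) B -> A `&` B = set0 ->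
  mm_mu X (A `|` B) = mm_mu X A + mm_mu X B.
Proof.
move=> hA hB AB0; have [m0 _ madd] := mm_measure X.
have hF n : dborel (mm_d X) (bigcup2 A B n) by case: n => [|[|n]] //=; exact: dborel0.
have /(madd _ hF) : trivIset setT (bigcup2 A B) by rewrite -trivIset_bigcup2.
rewrite bigcup2E => hl; apply: (@cvg_unique _ (@norm_hausdorff _ _)) hl _ => /=.
apply: cvg_near_cst; exists 2%N => // -[|[|n]] //= _.
by rewrite !big_ord_recl /= big1 ?addr0.
Qed.

Lemma mm_mu_le (R : realType) (X : mmspace R) (A B : set (mm_pt X)) :
  dborel (mm_d X) A -> dborel (mm_d X) B -> A `<=` B -> mm_mu X A <= mm_mu X B.
Proof.
move=> hA hB AB; rewrite -(setDUK AB) mm_muU ?setDIK // ?lerDl ?mm_mu_ge0 //; exact: dborelD.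
Qed.

Lemma mm_muC (R : realType) (X : mmspace R) (A : set (mm_pt X)) :
  dborel (mm_d X) A -> mm_mu X (~` A) = mm_mu X setT - mm_mu X A.
Proof.
move=> hA; rewrite -(setUv A) mm_muU ?setICr //; last exact: dborelC.
by rewrite addrC addKr.
Qed.

Lemma metric_refl (R : realType) (T : Type) (d : T -> T -> R) (x : T) :
  is_metric d -> d x x = 0.
Proof. by case=> _ h _ _; exact/h. Qed.

Lemma dopen_nbhd (R : realType) (Z : Type) (d : Z -> Z -> R) (A : set Z) (e : R) :
  is_metric d -> dopen d (nbhd d A e).
Proof.
move=> [_ _ dC dT] x [y Ay dxy]; exists (e - d x y); first by rewrite subr_gt0.
move=> z dxz; exists y => //; apply: le_lt_trans (dT z x y) _.
by rewrite dC; lra.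
Qed.

Lemma dopen_ball (R : realType) (Z : Type) (d : Z -> Z -> R) (c : Z) (e : R) :
  is_metric d -> dopen d [set x | d x c < e].
Proof.
move=> md; rewrite (_ : [set x | _] = nbhd d [set c] e); first exact: dopen_nbhd.
by apply/seteqP; split => x /= => [?|[y ->]//]; exists c.
Qed.

(* [c] sends a point to the first listed ball that contains it, so that its fibres
   are Borel. *)
Lemma compact_cell (R : realType) (T : Type) (d : T -> T -> R) (e : R) :
  is_metric d -> dcompact d -> inhabited T -> 0 < e ->
  exists (p : nat) (x : 'I_p -> T) (c : T -> 'I_p),
    (forall y, d y (x (c y)) < e) /\
    (forall S : set 'I_p, dborel d (c @^-1` S)).
Proof.
move=> md cT [t0] e0.
have [s hs] := cT T (fun c => [set x | d x c < e]) (fun c => dopen_ball md)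
  (fun x => ex_intro (fun c => d x c < e) x
    (eq_ind_r (fun t => t < e) e0 (metric_refl x md))).
pose close y c := d y c < e.
have {}hs y : has (close y) s.
  have [c [+ /= dc]] := hs y; elim: s {hs} => //= b s IH [->|/IH ->].
    by rewrite /close dc.
  by rewrite orbT.
have cP y : (find (close y) s < size s)%N by rewrite -has_find.
pose c y := Ordinal (cP y).
exists (size s), (fun i => nth t0 s i), c; split => [y|S].
  exact: (nth_find t0 (hs y)).
have oB c' : dborel d [set x | d x c' < e] by by apply: dborel_open; apply: dopen_ball.
have hF (n : nat) : dborel d [set y | (find (close y) s < n)%N].
  elim: n => [|n IH].
    rewrite (_ : [set y | _] = set0); first exact: dborel0.
    by apply/seteqP; split => y /=; rewrite ?ltn0.
  have [sn|ns] := leqP (size s) n.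
    rewrite (_ : [set y | _] = setT); first exact: dborelT.
    by apply/seteqP; split => // y _ /=; rewrite ltnS (leq_trans (ltnW (cP y))).
  rewrite (_ : [set y | _] = [set y | (find (close y) s < n)%N] `|`
     [set y | d y (nth t0 s n) < e]); first exact: dborelU.
  apply/seteqP; split => y /=.
    rewrite ltnS leq_eqVlt => /orP[/eqP fn|?]; last by left.
    by right; rewrite -fn; exact: (nth_find t0 (hs y)).
  case=> [/ltnW//|dy]; rewrite ltnNge; apply/negP => /(before_find t0).
  by rewrite /close dy.
have {}hF (n : nat) : dborel d [set y | find (close y) s = n].
  rewrite (_ : [set y | _] = [set y | (find (close y) s < n.+1)%N] `\`
     [set y | (find (close y) s < n)%N]); first exact: dborelD.
  apply/seteqP; split => y /=; first by move=> ->; rewrite ltnS leqnn ltnn.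
  by case=> + /negP; rewrite ltnS -leqNgt => h1 h2; apply/eqP; rewrite eqn_leq h1.
rewrite (_ : c @^-1` S = \bigcup_n (if pselect (exists2 i, S i & n = i :> nat)
   then [set y | find (close y) s = n] else set0)).
  by apply: dborel_bigcup => n; case: pselect => ?; [exact: hF|exact: dborel0].
apply/seteqP; split => y /=.
  move=> Sy; exists (c y : nat) => //.
  by case: pselect => // -[]; exists (c y).
case=> n _; case: pselect => [[i Si ni]|//] /= fi.
by rewrite (_ : c y = i) //; apply/val_inj; rewrite /= fi.
Qed.

(** * Approximate domination *)

(* [dom r X Y]: up to an error [r], [Y] lies below [X] for the order [mm_le]. The
   surjection X -> Y is weakened to a relation, which makes composition exact. *)
Definition dom (R : realType) (r : R) (X Y : mmspace R) : Prop :=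
  exists C : mm_pt X -> mm_pt Y -> Prop,
    [/\ forall y, exists x, C x y,
        forall x y x' y', C x y -> C x' y' -> mm_d Y y y' <= mm_d X x x' + r &
        forall B, dborel (mm_d Y) B -> exists A,
          [/\ dborel (mm_d X) A, mm_mu Y B <= mm_mu X A + r &
              forall x, A x -> exists2 y, B y & C x y]].

Lemma dom_trans (R : realType) (r s : R) (X Y Z : mmspace R) :
  dom r X Y -> dom s Y Z -> dom (r + s) X Z.
Proof.
move=> [C [Cs Cd Cm]] [D [Ds Dd Dm]].
exists (fun x z => exists2 y, C x y & D y z); split.
- by move=> z; have [y yz] := Ds z; have [x xy] := Cs y; exists x, y.
- move=> x z x' z' [y xy yz] [y' xy' yz'].
  have := Cd _ _ _ _ xy xy'; have := Dd _ _ _ _ yz yz'; lra.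
- move=> B /Dm[A [/Cm[A' [hA' m' s']] m h]]; exists A'; split => //; first lra.
  by move=> x /s'[y /h[z Bz yz] xy]; exists z => //; exists y.
Qed.

Lemma dom_le (R : realType) (r s : R) (X Y : mmspace R) :
  r <= s -> dom r X Y -> dom s X Y.
Proof.
move=> rs [C [Cs Cd Cm]]; exists C; split => //.
- by move=> x y x' y' xy xy'; apply: le_trans (Cd _ _ _ _ xy xy') _; lra.
- by move=> B /Cm[A [hA m h]]; exists A; split => //; lra.
Qed.

Lemma mm_le_dom (R : realType) (X Y : mmspace R) : mm_le X Y -> dom 0 Y X.
Proof.
move=> [phi [phis phi1 phim]]; exists (fun y x => phi y = x); split => //.
- by move=> x y x' y' <- <-; rewrite addr0.
- move=> B hB; exists (phi @^-1` B); rewrite addr0; split => //; last first.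
    by move=> x ?; exists (phi x).
  + exact: phim.
  + exact: dborel_preimage hB.
Qed.

Lemma mm_diam (R : realType) (X : mmspace R) :
  exists2 D : R, 0 <= D & forall x y, mm_d X x y <= D.
Proof.
have [d0 _ dC dT] := mm_metric X; have [x0] := mm_inhabited X.
have [p [x [c [hc _]]]] := compact_cell (mm_metric X) (mm_compact X)
  (mm_inhabited X) ltr01.
pose B := \sum_(i < p) mm_d X (x i) x0.
have hB y : mm_d X y x0 <= 1 + B.
  apply: le_trans (dT _ (x (c y)) _) _; apply: lerD; first exact/ltW/hc.
  by rewrite /B (bigD1 (c y)) //= lerDl sumr_ge0.
exists (1 + B + (1 + B)); first by rewrite !addr_ge0 // sumr_ge0.
by move=> u v; apply: le_trans (dT _ x0 _) _; rewrite lerD // dC.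
Qed.

(** Relating everything to everything costs at most the diameter of [Y], and giving up all its mass
    costs the total mass. It makes the set of errors nonempty, without which the infimum in [domq]
    would carry no information. *)
Lemma dom_bounded (R : realType) (X Y : mmspace R) :
  exists2 r : R, 0 <= r & dom r X Y.
Proof.
have [D D0 hD] := mm_diam Y.
have [d0X _ _ _] := mm_metric X; have [x0] := mm_inhabited X.
have m0 := mm_mu_ge0 (@dborelT _ _ (mm_d Y)).
exists (D + mm_mu Y setT); first by rewrite addr_ge0.
exists (fun _ _ => True); split; first by move=> _; exists x0.
  by move=> x y x' y' _ _; have := hD y y'; have := d0X x x'; lra.
move=> B hB; exists set0; split => //; first exact: dborel0.
have := mm_mu_le hB (@dborelT _ _ (mm_d Y)) (@subsetT _ _).
have := mm_mu_ge0 (@dborel0 _ _ (mm_d X)); lra.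
Qed.

(* Disjoint union of [X] and [Y] in which related points are at distance [e]. *)
Definition gluing (R : realType) (S T : Type) (dS : S -> S -> R) (dT : T -> T -> R)
  (C : S -> T -> Prop) (e : R) (u v : S + T) : R :=
  let cross x y := inf [set r | exists x' y', C x' y' /\ r = dS x x' + e + dT y' y] in
  match u, v with
  | inl x, inl x' => dS x x'
  | inr y, inr y' => dT y y'
  | inl x, inr y | inr y, inl x => cross x y
  end.

Lemma gluing_lb (R : realType) (S T : Type) (dS : S -> S -> R) (dT : T -> T -> R)
  (C : S -> T -> Prop) (e c : R) (x : S) (y : T) :
  (exists x y, C x y) -> (forall x' y', C x' y' -> c <= dS x x' + e + dT y' y) ->
  c <= gluing dS dT C e (inl x) (inr y).
Proof.
move=> [x0 [y0 C0]] h; apply: lb_le_inf.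
  by exists (dS x x0 + e + dT y0 y), x0, y0.
by move=> _ [x' [y' [C' ->]]]; exact: h.
Qed.

Lemma gluing_ub (R : realType) (S T : Type) (dS : S -> S -> R) (dT : T -> T -> R)
  (C : S -> T -> Prop) (e : R) (x x' : S) (y y' : T) :
  is_metric dS -> is_metric dT -> 0 < e -> C x' y' ->
  gluing dS dT C e (inl x) (inr y) <= dS x x' + e + dT y' y.
Proof.
move=> [d0 _ _ _] [d0' _ _ _] e0 C'; apply: ge_inf; last by exists x', y'.
exists 0 => _ [x1 [y1 [_ ->]]].
by have := d0 x x1; have := d0' y1 y; lra.
Qed.

(** The critical triangles have two vertices in one space and one in the other: the detour crosses
    twice and pays [2 * e], exactly the distortion allowed to [C]. *)
Lemma gluing_metric (R : realType) (S T : Type) (dS : S -> S -> R) (dT : T -> T -> R)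
  (C : S -> T -> Prop) (e : R) :
  is_metric dS -> is_metric dT -> 0 < e -> (exists x y, C x y) ->
  (forall x y x' y', C x y -> C x' y' -> `|dS x x' - dT y y'| <= 2 * e) ->
  is_metric (gluing dS dT C e).
Proof.
move=> mS mT e0 C0 hC.
have [d0 dE dC dtr] := mS; have [d0' dE' dC' dtr'] := mT.
have ge_e x y : e <= gluing dS dT C e (inl x) (inr y).
  by apply: gluing_lb => // x' y' _; have := d0 x x'; have := d0' y' y; lra.
have sym x y : gluing dS dT C e (inr y) (inl x) = gluing dS dT C e (inl x) (inr y) by [].
have triS x x' y :
    gluing dS dT C e (inl x) (inr y) <= dS x x' + gluing dS dT C e (inl x') (inr y).
  rewrite -lerBlDl; apply: gluing_lb => // x1 y1 C1.
  have := gluing_ub x y mS mT e0 C1; have := dtr x x' x1; lra.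
have triT x y y' :
    gluing dS dT C e (inl x) (inr y) <= gluing dS dT C e (inl x) (inr y') + dT y' y.
  rewrite -lerBlDr; apply: gluing_lb => // x1 y1 C1.
  have := gluing_ub x y mS mT e0 C1; have := dtr' y1 y' y; lra.
have triST x x' y :
    dS x x' <= gluing dS dT C e (inl x) (inr y) + gluing dS dT C e (inl x') (inr y).
  rewrite -lerBlDr; apply: gluing_lb => // x1 y1 C1.
  rewrite lerBlDr -lerBlDl; apply: gluing_lb => // x2 y2 C2.
  have := hC _ _ _ _ C1 C2; rewrite ler_norml => /andP[_].
  have := dtr x x1 x'; have := dtr x1 x2 x'; have := dC x' x2.
  have := dtr' y1 y y2; have := dC' y y2; lra.
have triTS x y y' :
    dT y y' <= gluing dS dT C e (inl x) (inr y) + gluing dS dT C e (inl x) (inr y').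
  rewrite -lerBlDr; apply: gluing_lb => // x1 y1 C1.
  rewrite lerBlDr -lerBlDl; apply: gluing_lb => // x2 y2 C2.
  have := hC _ _ _ _ C1 C2; rewrite ler_norml => /andP[+ _].
  have := dtr' y y1 y'; have := dtr' y1 y2 y'; have := dC' y y1.
  have := dtr x1 x x2; have := dC x1 x; lra.
split.
- case=> [x|y] [x'|y']; rewrite ?sym; [exact: d0| | |exact: d0'].
  + exact: le_trans (ltW e0) (ge_e x y').
  + exact: le_trans (ltW e0) (ge_e x' y).
- case=> [x|y] [x'|y']; rewrite ?sym.
  + by split => [/dE->//|[->]]; apply/dE.
  + by split => // h; have := ge_e x y'; rewrite h leNgt e0.
  + by split => // h; have := ge_e x' y; rewrite h leNgt e0.
  + by split => [/dE'->//|[->]]; apply/dE'.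
- by case=> [x|y] [x'|y']; [exact: dC|rewrite sym|rewrite sym|exact: dC'].
- case=> [x|y] [x'|y'] [x''|y'']; rewrite ?sym.
  + exact: dtr.
  + exact: triS.
  + exact: triST.
  + exact: triT.
  + by rewrite addrC /= dC; exact: triS.
  + exact: triTS.
  + by rewrite addrC /= dC'; exact: triT.
  + exact: dtr'.
Qed.

(** * Domination and the GHP distance *)

Lemma inf_nonneg (R : realType) (E : set R) : (forall x, E x -> 0 <= x) -> 0 <= inf E.
Proof.
move=> h; have [->|/set0P E0] := eqVneq E set0; first by rewrite inf0.
exact: lb_le_inf.
Qed.

(** One common embedding and one threshold for both the Hausdorff and the Prokhorov part, in place
    of three nested infima. It agrees with [dGHP] up to a factor 2. *)
Definition ghp_close (R : realType) (e : R) (X Y : mmspace R) : Prop :=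
  exists (Z : Type) (dZ : Z -> Z -> R) (f : mm_pt X -> Z) (g : mm_pt Y -> Z),
    [/\ is_metric dZ, isometric (mm_d X) dZ f, isometric (mm_d Y) dZ g,
        range f `<=` nbhd dZ (range g) e /\ range g `<=` nbhd dZ (range f) e &
        forall F, dclosed dZ F ->
          mm_mu X (f @^-1` F) <= mm_mu Y (g @^-1` nbhd dZ F e) + e /\
          mm_mu Y (g @^-1` F) <= mm_mu X (f @^-1` nbhd dZ F e) + e].

Lemma ghp_close_sym (R : realType) (e : R) (X Y : mmspace R) : ghp_close e X Y -> ghp_close e Y X.
Proof.
move=> [Z [dZ [f [g [mZ hf hg [fg gf] h]]]]]; exists Z, dZ, g, f; split => //.
by move=> F /h[].
Qed.

Lemma isometric_borel (R : realType) (S T : Type) (dS : S -> S -> R)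
  (dT : T -> T -> R) (f : S -> T) (A : set T) :
  isometric dS dT f -> dborel dT A -> dborel dS (f @^-1` A).
Proof. by move=> hf; apply: dborel_preimage => x y; rewrite hf. Qed.

Lemma nbhd_le (R : realType) (Z : Type) (d : Z -> Z -> R) (A : set Z) (e e' : R) :
  e <= e' -> nbhd d A e `<=` nbhd d A e'.
Proof. by move=> ee' z [y Ay zy]; exists y => //; exact: lt_le_trans ee'. Qed.

Lemma hausdorff_ge0 (R : realType) (Z : Type) (d : Z -> Z -> R) (A B : set Z) :
  0 <= hausdorff d A B.
Proof. by apply: inf_nonneg => r [/ltW]. Qed.

Lemma prokhorov_ge0 (R : realType) (Z : Type) (d : Z -> Z -> R)
  (nu nu' : set Z -> \bar R) : 0 <= prokhorov d nu nu'.
Proof. by apply: inf_nonneg => r [/ltW]. Qed.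

Lemma ghp_close_dGHP (R : realType) (e : R) (X Y : mmspace R) :
  0 < e -> ghp_close e X Y -> dGHP X Y <= e + e.
Proof.
move=> e0 [Z [dZ [f [g [mZ hf hg [fg gf] h]]]]].
apply: (@le_trans _ _ (hausdorff dZ (range f) (range g)
    + prokhorov dZ (fun A => (mm_mu X (f @^-1` A))%:E)
                   (fun A => (mm_mu Y (g @^-1` A))%:E))).
  apply: ge_inf; last by exists Z, dZ, f, g.
  exists 0 => _ [? [? [? [? [_ _ _ ->]]]]].
  by rewrite addr_ge0 ?hausdorff_ge0 ?prokhorov_ge0.
apply: lerD; (apply: ge_inf; first by exists 0 => ? [/ltW]) => //.
Qed.

(** The infimum of the empty set is 0 by convention, so an embedding can be extracted from a bound
    on [dGHP] only once some common embedding is known. Here all cross distances are made equal and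
    larger than both diameters. *)
Lemma dGHP_nonempty (R : realType) (X Y : mmspace R) :
  exists (Z : Type) (dZ : Z -> Z -> R) (f : mm_pt X -> Z) (g : mm_pt Y -> Z),
    [/\ is_metric dZ, isometric (mm_d X) dZ f & isometric (mm_d Y) dZ g].
Proof.
have [DX DX0 hX] := mm_diam X; have [DY DY0 hY] := mm_diam Y.
have [x0] := mm_inhabited X; have [y0] := mm_inhabited Y.
have [dX _ _ _] := mm_metric X; have [dY _ _ _] := mm_metric Y.
exists (mm_pt X + mm_pt Y)%type,
  (gluing (mm_d X) (mm_d Y) (fun _ _ => True) (DX + DY + 1)), inl, inr; split => //.
apply: gluing_metric; [exact: mm_metric|exact: mm_metric|lra|by exists x0, y0|].
move=> x y x' y' _ _; rewrite ler_norml.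
have := hX x x'; have := hY y y'; have := dX x x'; have := dY y y'.
by move=> *; apply/andP; split; lra.
Qed.

Lemma dGHP_close (R : realType) (e : R) (X Y : mmspace R) :
  dGHP X Y < e -> ghp_close e X Y.
Proof.
move=> /inf_lt[|_ [Z [dZ [f [g [mZ hf hg ->]]]]]].
  have [Z [dZ [f [g [mZ hf hg]]]]] := dGHP_nonempty X Y.
  by eexists; exists Z, dZ, f, g; split.
set H := hausdorff _ _ _; set Q := prokhorov _ _ _ => HQ.
have [dZ0 _ dZC dZtr] := mZ.
have [DX DX0 hX] := mm_diam X; have [DY DY0 hY] := mm_diam Y.
have [x0] := mm_inhabited X; have [y0] := mm_inhabited Y.
pose t := (e - H - Q) / 2; have t0 : 0 < t by rewrite /t; lra.
have Ht : H < H + t by rewrite ltrDl.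
have Qt : Q < Q + t by rewrite ltrDl.
have mB (F : set Z) : dclosed dZ F \/ dopen dZ F -> dborel dZ F.
  by case=> [/dclosed_borel|/dborel_open].
have fB F (h : dclosed dZ F \/ dopen dZ F) := isometric_borel hf (mB F h).
have gB F (h : dclosed dZ F \/ dopen dZ F) := isometric_borel hg (mB F h).
have [|e1 [e10 [fg gf]] e1H] := @inf_lt _ _ (H + t) _ Ht.
(* The sets behind [hausdorff] and [prokhorov] must likewise be shown nonempty: a radius exceeding
   both diameters plus a cross distance serves here, an error exceeding both masses serves below. *)
- exists (DX + DY + dZ (f x0) (g y0) + 1); split; last split.
  + by have := dZ0 (f x0) (g y0); lra.
  + move=> _ [x _ <-]; exists (g y0); first by exists y0.
    by have := dZtr (f x) (f x0) (g y0); rewrite hf; have := hX x x0; lra.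
  + move=> _ [y _ <-]; exists (f x0); first by exists x0.
    have := dZtr (g y) (g y0) (f x0); rewrite hg (dZC (g y0)).
    by have := hY y y0; lra.
have [|e2 [e20 hF] e2Q] := @inf_lt _ _ (Q + t) _ Qt.
- have mX := mm_mu_ge0 (@dborelT _ _ (mm_d X)).
  have mY := mm_mu_ge0 (@dborelT _ _ (mm_d Y)).
  exists (mm_mu X setT + mm_mu Y setT + 1); split; first lra.
  move=> F cF; rewrite -!EFinD !lee_fin.
  have oF (r : R) : dopen dZ (nbhd dZ F r) by exact: dopen_nbhd.
  have := mm_mu_le (fB F (or_introl cF)) (@dborelT _ _ _) (@subsetT _ _).
  have := mm_mu_le (gB F (or_introl cF)) (@dborelT _ _ _) (@subsetT _ _).
  have := mm_mu_ge0 (gB _ (or_intror (oF (mm_mu X setT + mm_mu Y setT + 1)))).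
  have := mm_mu_ge0 (fB _ (or_intror (oF (mm_mu X setT + mm_mu Y setT + 1)))).
  by move=> *; split; lra.
have H0 := hausdorff_ge0 dZ (range f) (range g).
have Q0 := prokhorov_ge0 dZ (fun A => (mm_mu X (f @^-1` A))%:E)
                   (fun A => (mm_mu Y (g @^-1` A))%:E).
have e1e : e1 <= e by rewrite /t in e1H; rewrite -/H in H0; rewrite -/Q in Q0; lra.
have e2e : e2 <= e by rewrite /t in e2Q; rewrite -/H in H0; rewrite -/Q in Q0; lra.
exists Z, dZ, f, g; split => //.
  by split; [move=> z /fg|move=> z /gf]; exact: nbhd_le.
have oF (F : set Z) (r : R) : dopen dZ (nbhd dZ F r) by exact: dopen_nbhd.
move=> F /hF; rewrite -!EFinD !lee_fin => -[h1 h2]; split.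
- apply: (le_trans h1); apply: lerD => //; apply: mm_mu_le.
  + exact: gB _ (or_intror (oF _ _)).
  + exact: gB _ (or_intror (oF _ _)).
  + by move=> y; exact: nbhd_le.
- apply: (le_trans h2); apply: lerD => //; apply: mm_mu_le.
  + exact: fB _ (or_intror (oF _ _)).
  + exact: fB _ (or_intror (oF _ _)).
  + by move=> y; exact: nbhd_le.
Qed.

Lemma ghp_close_dom (R : realType) (e : R) (X Y : mmspace R) :
  0 < e -> ghp_close e X Y -> dom (2 * e) X Y.
Proof.
move=> e0 [Z [dZ [f [g [mZ hf hg [fg gf] h]]]]].
have [dZ0 _ dZC dZtr] := mZ.
exists (fun x y => dZ (f x) (g y) < e); split.
- move=> y; have [|_ [x _ <-] gyx] := gf (g y); first by exists y.
  by exists x; rewrite dZC.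
- move=> x y x' y' xy xy'; rewrite -hf -hg.
  have := dZtr (g y) (f x) (g y'); have := dZtr (f x) (f x') (g y').
  by rewrite (dZC (g y) (f x)); lra.
(* The Prokhorov bound speaks of closed sets, so [B] is replaced by the closure [F] of its image.
   Being strictly within [e] of a point of [F] leaves room to move to a point of the image of
   [B]. *)
- move=> B hB; pose F := [set z | forall r, 0 < r -> exists2 y, B y & dZ z (g y) < r].
  have cF : dclosed dZ F.
    move=> z /= /existsNP[r /not_implyP[r0 nB]]; exists (r / 2); first lra.
    move=> z' zz' /(_ (r / 2)) []; first lra.
    move=> y By z'y; apply: nB; exists y => //.
    by have := dZtr z z' (g y); lra.
  exists (f @^-1` nbhd dZ F e); split.
  + by apply: isometric_borel hf _; apply: dborel_open; exact: dopen_nbhd.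
  + have [_ h2] := h F cF.
    have : mm_mu Y B <= mm_mu Y (g @^-1` F).
      apply: mm_mu_le => //.
        by apply: isometric_borel hg _; exact: dclosed_borel.
      by move=> y By r r0; exists y => //; rewrite metric_refl.
    lra.
  + move=> x [z /(_ (e - dZ (f x) z))+ xz]; rewrite subr_gt0 => /(_ xz) [y By zy].
    by exists y => //; have := dZtr (f x) z (g y); lra.
Qed.

Lemma dGHP_dom (R : realType) (e : R) (X Y : mmspace R) :
  0 < e -> dGHP X Y < e -> dom (2 * e) X Y /\ dom (2 * e) Y X.
Proof.
by move=> e0 /dGHP_close h; split; apply: ghp_close_dom => //; exact: ghp_close_sym.
Qed.

(* Quantitative form of: an expanding self-map of a compact space is an isometry.
   Two of the first iterates of a pair of points are ghp_close, hence, by expansion,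
   some iterate brings the pair almost back to itself. *)
Lemma almost_isometry (R : realType) (X : mmspace R) (e : R) : 0 < e ->
  exists2 rho : R, 0 < rho & forall h : mm_pt X -> mm_pt X,
    (forall x y, mm_d X x y <= mm_d X (h x) (h y) + rho) ->
    (forall x y, mm_d X (h x) (h y) <= mm_d X x y + e) /\
    (forall x, exists u, mm_d X x (h u) <= e).
Proof.
move=> e0; have [d0 _ dC dT] := mm_metric X.
(* Seven is 3 + 3 + 1: each point of the pair returns to within [3 * t] (two cell radii and
   accumulated expansion errors), and the expansion errors along the way cost one more [t]. *)
pose t := e / 7; have t0 : 0 < t by rewrite /t; lra.
have [p [ctr [c [hc _]]]] := compact_cell (mm_metric X) (mm_compact X)
  (mm_inhabited X) t0.
(* [M] counts the pairs of cells, so among [M.+1] iterates of a pair of points two share their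
   cells; [rho] is chosen so that up to [M.+1] errors sum to at most [t]. *)
pose M := (p * p)%N; pose rho := t / M.+1%:R.
have rho0 : 0 < rho by rewrite divr_gt0.
have kt (k : nat) : (k <= M.+1)%N -> k%:R * rho <= t.
  move=> kM; rewrite /rho mulrCA ler_piMr ?(ltW t0) // ler_pdivrMr ?mul1r //.
  by rewrite ler_nat.
exists rho => // h hh.
have iterh k x y : mm_d X x y <= mm_d X (iter k h x) (iter k h y) + k%:R * rho.
  elim: k => [|k IH]; first by rewrite mul0r addr0.
  apply: (le_trans IH); rewrite iterS -natr1 mulrDl mul1r.
  by have := hh (iter k h x) (iter k h y); lra.
have key x y : exists k, [/\ (k <= M)%N, mm_d X x (iter k.+1 h x) <= 3 * t &
    mm_d X y (iter k.+1 h y) <= 3 * t].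
  pose F (i : 'I_M.+1) := (c (iter i h x), c (iter i h y)).
  have : ~~ injectiveb F.
    apply/negP => /injectiveP/leq_card.
    by rewrite card_prod !card_ord ltnn.
  move=> /injectivePn[i [j ij Fij]].
  wlog {ij} ltij : i j Fij / (i < j)%N.
    move=> H; case: (ltngtP i j) => [|/H|/val_inj/eqP]; [exact: H|exact|].
    by rewrite (negPf ij).
  have jE : j = (i + (j - i.+1).+1)%N :> nat by rewrite subnSK // subnKC // ltnW.
  have jM : (j < M.+1)%N by [].
  have near u : c (iter i h u) = c (iter j h u) ->
      mm_d X u (iter (j - i.+1).+1 h u) <= 3 * t.
    move=> cu; have := iterh i u (iter (j - i.+1).+1 h u).
    rewrite -iterD -jE; have := kt i (ltnW (ltn_ord i)).
    have := dT (iter i h u) (ctr (c (iter i h u))) (iter j h u).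
    have := hc (iter i h u); have := hc (iter j h u).
    rewrite -cu (dC (iter j h u)); lra.
  by exists (j - i.+1)%N; case: Fij => /near ? /near ?; split => //; lia.
split.
- move=> x y; have [k [kM kx ky]] := key x y.
  have := iterh k (h x) (h y); rewrite -!iterSr.
  have := dT (iter k.+1 h x) x (iter k.+1 h y).
  have := dT x y (iter k.+1 h y); rewrite (dC _ x).
  have := kt k (leqW kM); rewrite /t in t0 kx ky *; lra.
- move=> x; have [k [_ kx _]] := key x x; exists (iter k h x).
  by apply: (le_trans kx); rewrite /t; lra.
Qed.

(** The relation [C] bounds distances in [Z] by those in [X], but gluing along [C] needs the reverse
    as well. It comes from going to [Z] and back: the resulting self-map [h] of [X] expands up to
    [2 * r], hence is nearly an isometry and nearly onto by [almost_isometry]. *)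
Lemma dom_antisym (R : realType) (X : mmspace R) (e : R) : 0 < e ->
  exists2 r : R, 0 < r & forall Z, dom r X Z -> dom r Z X -> dGHP X Z < e.
Proof.
move=> e0; have [d0 _ dC dT] := mm_metric X.
(* The distortion of [C] will be at most [8 * t], so the gluing distance is [4 * t]; the images are
   then [6 * t]-close, and [dGHP] is at most [12 * t]. *)
pose t := e / 13; have t0 : 0 < t by rewrite /t; lra.
have [rho rho0 hrho] := almost_isometry X t0.
pose r := Num.min (rho / 2) t.
have [r_rho r_t] : 2 * r <= rho /\ r <= t.
  have : r <= rho / 2 by rewrite /r ge_min lexx.
  have : r <= t by rewrite /r ge_min lexx orbT.
  by move=> *; split; lra.
have r0 : 0 < r by rewrite /r lt_min t0 divr_gt0.
exists r => // Z [C [Cs Cd Cm]] [C' [Cs' Cd' Cm']].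
have [dZ0 _ dZC dZT] := mm_metric Z.
have [psi hpsi] := choice Cs'.
have [h hh] := choice (fun x => Cs (psi x)).
have [|h_iso h_onto] := hrho h.
- move=> x y; have := Cd' _ _ _ _ (hpsi x) (hpsi y).
  have := Cd _ _ _ _ (hh x) (hh y); lra.
(* The [8 * t]: [x] and [x'] are each moved by [t] onto the range of [h], [h] distorts by [t], [C']
   by [r <= t], and each of [z], [z'] lies within [t + r] of [psi u], [psi u']. *)
have Clow x z x' z' : C x z -> C x' z' -> mm_d X x x' <= mm_d Z z z' + 8 * t.
  move=> xz xz'; have [u xu] := h_onto x; have [u' xu'] := h_onto x'.
  have := Cd _ _ _ _ xz (hh u); have := Cd _ _ _ _ xz' (hh u').
  have := Cd' _ _ _ _ (hpsi u) (hpsi u'); have := h_iso u u'.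
  have := dT x (h u) x'; have := dT (h u) (h u') x'; rewrite (dC (h u') x').
  have := dZT (psi u) z (psi u'); have := dZT z z' (psi u').
  by rewrite (dZC (psi u) z); lra.
have [x0] := mm_inhabited X.
pose D := gluing (mm_d X) (mm_d Z) C (4 * t).
have t4 : 0 < 4 * t by lra.
have mX := mm_metric X; have mZ := mm_metric Z.
have mD : is_metric D.
  apply: gluing_metric => //; first by exists (h x0), (psi x0).
  move=> x z x' z' xz xz'; rewrite ler_norml; apply/andP; split.
    have := Cd _ _ _ _ xz xz'; lra.
  have := Clow _ _ _ _ xz xz'; lra.
have Dub x z x' : C x' z -> D (inl x) (inr z) <= mm_d X x x' + 4 * t.
  by move=> /(gluing_ub x z mX mZ t4); rewrite (metric_refl z mZ) addr0.
have DC : forall u v, D u v = D v u by have [] := mD.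
have cl : ghp_close (6 * t) X Z; last first.
  by apply: le_lt_trans (ghp_close_dGHP _ cl) _; rewrite /t in t0 *; lra.
exists (mm_pt X + mm_pt Z)%type, D, inl, inr; split => //.
  split=> [_ [x _ <-]|_ [z _ <-]].
    have [u xu] := h_onto x; exists (inr (psi u)); first by exists (psi u).
    have := Dub x _ _ (hh u); lra.
  have [x xz] := Cs z; exists (inl x); first by exists x.
  by have := Dub x _ _ xz; rewrite DC (metric_refl x mX); lra.
move=> F cF.
have oN : dopen D (nbhd D F (6 * t)) by exact: dopen_nbhd.
have iX : isometric (mm_d X) D inl by [].
have iZ : isometric (mm_d Z) D inr by [].
have FX := isometric_borel iX (dclosed_borel cF).
have FZ := isometric_borel iZ (dclosed_borel cF).
have NX := isometric_borel iX (dborel_open oN).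
have NZ := isometric_borel iZ (dborel_open oN).
split; last first.
  have [A [hA m sub]] := Cm _ FZ.
  have : mm_mu X A <= mm_mu X (inl @^-1` nbhd D F (6 * t)).
    apply: mm_mu_le => // x /sub[z Fz xz]; exists (inr z) => //.
    by have := Dub x _ _ xz; rewrite (metric_refl x mX); lra.
  lra.
(* The mass bound of [C] goes the wrong way for this inequality, so it is applied to the complement
   of the neighbourhood. Complements exchange the roles of the spaces once the total masses are
   compared, which [C'] does. *)
have [A [hA m sub]] := Cm _ (dborelC NZ).
have : mm_mu X A <= mm_mu X (~` (inl @^-1` F)).
  apply: mm_mu_le => //; first exact: dborelC.
  move=> x /sub[z nz xz] Fx; apply: nz; exists (inl x) => //.
  by have := Dub x _ _ xz; rewrite DC (metric_refl x mX); lra.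
have [A' [hA' m' _]] := Cm' _ (@dborelT _ _ _).
have := mm_mu_le hA' (@dborelT _ _ _) (@subsetT _ _).
rewrite mm_muC // in m; rewrite mm_muC //; lra.
Qed.

(* Spaces with a common code are close: [dom] then holds both ways. As codes are
   countable, this yields the separability of the GHP topology. *)
Definition ghp_code : Type :=
  {p : nat & ({ffun 'I_p * 'I_p -> nat} * {ffun {set 'I_p} -> nat})%type}.
HB.instance Definition _ := Countable.on ghp_code.

(** Masses are recorded for all unions of cells, not cell by cell: the rounding error of a mass is
    then [s] once, whatever the number of cells. *)
Definition has_code (R : realType) (s : R) (c : ghp_code) (X : mmspace R) : Prop :=
  exists (x : 'I_(tag c) -> mm_pt X) (cell : mm_pt X -> 'I_(tag c)),
    [/\ forall y, mm_d X y (x (cell y)) < s,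
        forall S : set 'I_(tag c), dborel (mm_d X) (cell @^-1` S),
        forall i j, (tagged c).1 (i, j) = Num.truncn (mm_d X (x i) (x j) / s) &
        forall S : {set 'I_(tag c)}, (tagged c).2 S =
          Num.truncn (mm_mu X (cell @^-1` [set` S]) / s)].

Lemma has_code_ex (R : realType) (s : R) (X : mmspace R) :
  0 < s -> exists c, has_code s c X.
Proof.
move=> s0; have [p [x [cell [h1 h2]]]] := compact_cell (mm_metric X) (mm_compact X)
  (mm_inhabited X) s0.
exists (existT _ p ([ffun ij => Num.truncn (mm_d X (x ij.1) (x ij.2) / s)],
   [ffun S : {set 'I_p} => Num.truncn (mm_mu X (cell @^-1` [set` S]) / s)])).
by exists x, cell; split => //= *; rewrite ffunE.
Qed.

Lemma truncn_eq_le (R : realType) (s u v : R) : 0 < s -> 0 <= u ->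
  Num.truncn (u / s) = Num.truncn (v / s) -> v <= u + s.
Proof.
move=> s0 u0 E; have /ltW := truncnS_gt (v / s).
rewrite -E -natr1 => h.
have : v / s <= u / s + 1 by apply: (le_trans h); rewrite lerD2r truncn_le // divr_ge0 // ltW.
by rewrite ler_pdivrMr // mulrDl mul1r divfK ?gt_eqF.
Qed.

(** Points are related when they are near centres with the same index. Replacing four points by
    their centres costs [4 * s], rounding the distance of the centres costs [s]. A Borel set is
    first enlarged to the union of the cells it meets. *)
Lemma has_code_dom (R : realType) (s : R) (c : ghp_code) (X Y : mmspace R) :
  0 < s -> has_code s c X -> has_code s c Y -> dom (5 * s) X Y.
Proof.
move=> s0 [x [cx [hx bx Dx Mx]]] [y [cy [hy by_ Dy My]]].
have [d0 _ dC dT] := mm_metric X; have [d0' _ dC' dT'] := mm_metric Y.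
exists (fun u v => exists2 i, mm_d X u (x i) < s & mm_d Y v (y i) < s); split.
- move=> v; exists (x (cy v)), (cy v) => //.
  by rewrite (metric_refl _ (mm_metric X)).
- move=> u v u' v' [i ui vi] [j uj vj].
  have := truncn_eq_le s0 (d0 (x i) (x j)) (etrans (esym (Dx i j)) (Dy i j)).
  have := dT' v (y i) v'; have := dT' (y i) (y j) v'; rewrite (dC' (y j) v').
  have := dT (x i) u (x j); have := dT u u' (x j); rewrite (dC (x i) u).
  lra.
- move=> B hB; pose S : {set 'I_(tag c)} := [set i | `[< exists2 v, B v & cy v = i >]]%SET.
  have bS := bx [set` S]; have bS' := by_ [set` S].
  exists (cx @^-1` [set` S]); split => //.
    have := truncn_eq_le s0 (mm_mu_ge0 bS) (etrans (esym (Mx S)) (My S)).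
    suff : mm_mu Y B <= mm_mu Y (cy @^-1` [set` S]) by lra.
    apply: mm_mu_le => // v Bv /=; rewrite inE; apply/asboolP; by exists v.
  move=> u /=; rewrite inE => /asboolP[v Bv cyv]; exists v => //.
  by exists (cx u) => //; rewrite -cyv.
Qed.

Lemma dom_scale (R : realType) (a b : {posnum R}) (r : R) (X Y : mmspace R) :
  0 <= r -> dom r X Y ->
  dom (Num.max a%:num b%:num * r) (mmscale a b X) (mmscale a b Y).
Proof.
move=> r0 [C [Cs Cd Cm]]; set m := Num.max _ _.
have [am bm] : a%:num <= m /\ b%:num <= m by rewrite !le_max !lexx orbT.
exists C; split => //.
- move=> x y x' y' xy xy' /=.
  apply: (@le_trans _ _ (a%:num * (mm_d X x x' + r))).
    by rewrite ler_pM2l //; exact: Cd.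
  by rewrite mulrDr lerD2l ler_wpM2r.
- move=> B; rewrite /= dborel_scale // => /Cm[A [hA mA sub]].
  exists A; split => //=; first by rewrite dborel_scale.
  apply: (@le_trans _ _ (b%:num * (mm_mu X A + r))); first by rewrite ler_pM2l.
  by rewrite mulrDr lerD2l ler_wpM2r.
Qed.

Lemma dom_scale_near1 (R : realType) (r : R) (X : mmspace R) : 0 < r ->
  exists2 t : R, 0 < t & forall a b : {posnum R}, `|a%:num - 1| <= t ->
    `|b%:num - 1| <= t -> dom r X (mmscale a b X) /\ dom r (mmscale a b X) X.
Proof.
move=> r0; have [D D0 hD] := mm_diam X.
have m0 := mm_mu_ge0 (@dborelT _ _ (mm_d X)).
have [d0 _ _ _] := mm_metric X.
(* [K] bounds distances and masses alike, so a factor within [r / K] of 1 changes either by at most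
   [r]; the summand 1 keeps [K] positive. *)
pose K := D + mm_mu X setT + 1; have K0 : 0 < K by rewrite /K; lra.
exists (r / K) => [|a b]; first exact: divr_gt0.
rewrite !ler_norml => ha hb.
have hK (u c : R) : 0 <= u -> u <= K -> - (r / K) <= c - 1 <= r / K ->
    c * u <= u + r /\ u <= c * u + r.
  move=> u0 uK /andP[c1 c2].
  have ur : r / K * u <= r by rewrite mulrAC ler_pdivrMr // ler_wpM2l // ltW.
  have := ler_wpM2r u0 c1; have := ler_wpM2r u0 c2.
  by rewrite mulNr mulrBl mul1r => *; split; lra.
have dK x y : mm_d X x y <= K by have := hD x y; rewrite /K; lra.
have mK A : dborel (mm_d X) A -> mm_mu X A <= K.
  move=> hA; have := mm_mu_le hA (@dborelT _ _ _) (@subsetT _ _); rewrite /K; lra.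
have hd x y := hK _ _ (d0 x y) (dK x y) ha.
have hm A (hA : dborel (mm_d X) A) := hK _ _ (mm_mu_ge0 hA) (mK A hA) hb.
split; exists eq; split => /=.
- by move=> y; exists y.
- by move=> x y x' y' -> ->; have [] := hd y y'.
- move=> B; rewrite dborel_scale // => hB; exists B; split => //.
    by have [] := hm B hB.
  by move=> x Bx; exists x.
- by move=> y; exists y.
- by move=> x y x' y' -> ->; have [] := hd y y'.
- move=> B hB; exists B; split => //; first by rewrite dborel_scale.
    by have [] := hm B hB.
  by move=> x Bx; exists x.
Qed.

(** * Monotone continuous functions on the space of spaces *)

(** An asymmetric pseudo-distance: it satisfies the triangle inequality and vanishes along [mm_le],
    which is what makes it monotone in each argument. *)
Definition domq (R : realType) (X Y : mmspace R) : R :=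
  inf [set r | 0 <= r /\ dom r X Y].

Lemma domq_ge0 (R : realType) (X Y : mmspace R) : 0 <= domq X Y.
Proof. by apply: inf_nonneg => r []. Qed.

Lemma domq_lt (R : realType) (s : R) (X Y : mmspace R) : domq X Y < s -> dom s X Y.
Proof.
move=> /inf_lt[|r [r0 h] rs]; last exact: dom_le (ltW rs) h.
by have [r r0 h] := dom_bounded X Y; exists r.
Qed.

Lemma domq_le (R : realType) (r : R) (X Y : mmspace R) :
  0 <= r -> dom r X Y -> domq X Y <= r.
Proof. by move=> r0 h; apply: ge_inf => //; exists 0 => ? []. Qed.

Lemma domq_trans (R : realType) (X Y Z : mmspace R) :
  domq X Z <= domq X Y + domq Y Z.
Proof.
apply/ler_addgt0Pr => e e0.
have XY : dom (domq X Y + e / 2) X Y by apply: domq_lt; lra.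
have YZ : dom (domq Y Z + e / 2) Y Z by apply: domq_lt; lra.
have -> : domq X Y + domq Y Z + e = domq X Y + e / 2 + (domq Y Z + e / 2) by field.
apply: domq_le (dom_trans XY YZ).
by have := domq_ge0 X Y; have := domq_ge0 Y Z; lra.
Qed.

Lemma mm_le_domq (R : realType) (X Y : mmspace R) : mm_le X Y -> domq Y X = 0.
Proof.
by move=> /mm_le_dom h; apply/eqP; rewrite eq_le domq_ge0 andbT; exact: domq_le.
Qed.

Lemma dGHP_domq (R : realType) (e : R) (X Y : mmspace R) :
  0 < e -> dGHP X Y < e -> domq X Y <= 2 * e /\ domq Y X <= 2 * e.
Proof.
by move=> e0 /(dGHP_dom e0)[h1 h2]; split; apply: domq_le => //; lra.
Qed.

(** The plateau matters: a bump reaches the value 1 exactly, so that a finite product of factors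
    [1 - bump] reaches 0 exactly. *)
Definition ramp (R : realType) (x : R) : R := Num.max 0 (Num.min 1 (2 - x)).

Lemma ramp01 (R : realType) (x : R) : 0 <= ramp x <= 1.
Proof. by rewrite /ramp le_max lexx /= ge_max ler01 ge_min lexx. Qed.

Lemma ramp1 (R : realType) (x : R) : x <= 1 -> ramp x = 1.
Proof. by move=> x1; rewrite /ramp min_l ?max_r //; lra. Qed.

Lemma ramp_gt0 (R : realType) (x : R) : 0 < ramp x -> x < 2.
Proof. by rewrite /ramp lt_max ltxx /= lt_min subr_gt0 => /andP[]. Qed.

Lemma rampP (R : realType) (x : R) : (x <= 1 /\ ramp x = 1) \/
  [/\ 1 <= x, x <= 2 & ramp x = 2 - x] \/ (2 <= x /\ ramp x = 0).
Proof.
have [x1|x1] := leP x 1; first by left; split => //; exact: ramp1.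
right; rewrite /ramp min_r; last lra.
have [x2|x2] := leP x 2; first by left; split; rewrite ?max_r //; lra.
by right; split; rewrite ?max_l //; lra.
Qed.

Lemma ramp_le (R : realType) (x y : R) : x <= y -> ramp y <= ramp x.
Proof.
by move=> xy; case: (rampP x) => [[? ->]|[[? ? ->]|[? ->]]];
  case: (rampP y) => [[? ->]|[[? ? ->]|[? ->]]]; lra.
Qed.

Lemma ramp_lip (R : realType) (x y : R) : x <= y -> ramp x <= ramp y + (y - x).
Proof.
by move=> xy; case: (rampP x) => [[? ->]|[[? ? ->]|[? ->]]];
  case: (rampP y) => [[? ->]|[[? ? ->]|[? ->]]]; lra.
Qed.

Lemma ramp_dist (R : realType) (x y t : R) : `|x - y| <= t -> `|ramp x - ramp y| <= t.
Proof.
rewrite !ler_norml => /andP[? ?]; case: (leP x y) => [xy|/ltW xy].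
  by have := ramp_le xy; have := ramp_lip xy => *; apply/andP; split; lra.
by have := ramp_le xy; have := ramp_lip xy => *; apply/andP; split; lra.
Qed.

Definition continuous01 (R : realType) (f : mmspace R -> R) : Prop :=
  GHP_continuous f /\ forall X, 0 <= f X <= 1.

Definition test_fun (R : realType) (p : mmspace R -> R) : Prop :=
  continuous01 p /\ forall X X', mm_le X X' -> p X <= p X'.

Lemma continuous01_onem (R : realType) (f : mmspace R -> R) :
  continuous01 f -> continuous01 (fun X => 1 - f X).
Proof.
move=> [fc f01]; split=> [X e /(fc X)[t t0 ht]|X].
  exists t => // Y /ht; rewrite !ltr_norml => /andP[? ?]; apply/andP; split; lra.
by have := f01 X => /andP[? ?]; apply/andP; split; lra.
Qed.

Lemma continuous01_mul (R : realType) (f g : mmspace R -> R) :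
  continuous01 f -> continuous01 g -> continuous01 (fun X => f X * g X).
Proof.
move=> [fc f01] [gc g01]; split=> [X e e0|X]; last first.
  have /andP[f0 f1] := f01 X; have /andP[g0 g1] := g01 X.
  by rewrite mulr_ge0 // mulr_ile1.
have [t t0 ht] := fc X (e / 2) ltac:(lra).
have [s s0 hs] := gc X (e / 2) ltac:(lra).
exists (Num.min s t); first by rewrite lt_min s0.
move=> Y; rewrite lt_min => /andP[/hs h1 /ht h2].
have /andP[f0 f1] := f01 Y; have /andP[g0 g1] := g01 X.
rewrite (_ : f X * g X - f Y * g Y = (f X - f Y) * g X + f Y * (g X - g Y)); last ring.
apply: (le_lt_trans (ler_normD _ _)); rewrite !normrM (ger0_norm f0) (ger0_norm g0).
have := ler_piMr (normr_ge0 (f X - f Y)) g1.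
have := ler_piMl (normr_ge0 (g X - g Y)) f1.
lra.
Qed.

Lemma continuous01_domq (R : realType) (s : R) (F : mmspace R -> R) : 0 < s ->
  (forall (t : R) X Y, 0 < t -> dGHP X Y < t -> `|F X - F Y| <= 2 * t) ->
  continuous01 (fun X => ramp (F X / s)).
Proof.
move=> s0 hF; split=> [X e e0|X]; last exact: ramp01.
exists (e * s / 4); first by rewrite divr_gt0 ?mulr_gt0.
move=> Y /(hF _ _ _ _) h; apply: (@le_lt_trans _ _ (e / 2)); last lra.
apply: ramp_dist; rewrite -mulrBl normrM normfV (gtr0_norm s0) ler_pdivrMr //.
by apply: le_trans (h _) _; [rewrite divr_gt0 ?mulr_gt0|lra].
Qed.

(** If [X'] is above [X] then [domq X' X = 0], and the triangle inequality gives
    [domq X' W <= domq X W]; [ramp] reverses the order. The triangle inequality also gives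
    continuity. *)
Lemma test_fun_up (R : realType) (s : R) (W : mmspace R) :
  0 < s -> test_fun (fun X => ramp (domq X W / s)).
Proof.
move=> s0; split.
  apply: continuous01_domq => // t X Y t0 /(dGHP_domq t0)[h1 h2].
  rewrite ler_norml; have := domq_trans X Y W; have := domq_trans Y X W.
  by move=> *; apply/andP; split; lra.
move=> X X' /mm_le_domq h; apply: ramp_le; rewrite ler_pM2r ?invr_gt0 //.
by have := domq_trans X' X W; rewrite h add0r.
Qed.

Lemma test_fun_down (R : realType) (s : R) (W : mmspace R) :
  0 < s -> test_fun (fun X => 1 - ramp (domq W X / s)).
Proof.
move=> s0; split.
  apply/continuous01_onem/continuous01_domq => // t X Y t0 /(dGHP_domq t0)[h1 h2].
  rewrite ler_norml; have := domq_trans W X Y; have := domq_trans W Y X.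
  by move=> *; apply/andP; split; lra.
move=> X X' /mm_le_domq h; rewrite lerD2l lerN2; apply: ramp_le.
by rewrite ler_pM2r ?invr_gt0 //; have := domq_trans W X' X; rewrite h addr0.
Qed.

Lemma test_fun_mul (R : realType) (p q : mmspace R -> R) :
  test_fun p -> test_fun q -> test_fun (fun X => p X * q X).
Proof.
move=> [p1 pm] [q1 qm]; split; first exact: continuous01_mul.
move=> X X' XX'; have [_ /(_ X)/andP[p0 _]] := p1; have [_ /(_ X)/andP[q0 _]] := q1.
by rewrite ler_pM // ?pm ?qm.
Qed.

(** Distances and masses scale by different factors. [dom] absorbs both into their maximum, and
    [dom_antisym] returns to [dGHP]. *)
Lemma mmscale_continuous (R : realType) (a b : {posnum R}) (X : mmspace R) (t : R) :
  0 < t -> exists2 s : R, 0 < s & forall Y, dGHP X Y < s ->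
    dGHP (mmscale a b X) (mmscale a b Y) < t.
Proof.
move=> t0; have [r r0 hr] := dom_antisym (mmscale a b X) t0.
set m := Num.max a%:num b%:num; have m0 : 0 < m by rewrite lt_max gt0.
exists (r / (2 * m)) => [|Y]; first by rewrite divr_gt0 ?mulr_gt0.
have r2 : 0 < r / (2 * m) by rewrite divr_gt0 ?mulr_gt0.
have mr : m * (2 * (r / (2 * m))) = r by field; lra.
by move=> /(dGHP_dom r2)[h1 h2]; apply: hr; rewrite -mr; apply: dom_scale => //; lra.
Qed.

Lemma GHP_continuous_scale (R : realType) (a b : {posnum R}) (f : mmspace R -> R) :
  GHP_continuous f -> GHP_continuous (fun X => f (mmscale a b X)).
Proof.
move=> fc X e /(fc (mmscale a b X))[t t0 ht].
by have [s s0 hs] := mmscale_continuous a b X t0; exists s => // Y /hs/ht.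
Qed.

Lemma GHPborel_scale (R : realType) (a b : {posnum R}) (B : set (mmspace R)) :
  GHPborel B -> GHPborel (mmscale a b @^-1` B).
Proof.
suff : @GHPborel R `<=` [set B | GHPborel (mmscale a b @^-1` B)] by apply.
have [h0 hC hU] := smallest_sigma_algebra [set: mmspace R] (@GHPopen R).
apply: smallest_sub => [|U oU].
  split => /=.
  - by rewrite preimage_set0.
  - by move=> A hA; rewrite setTD preimage_setC -setTD; exact: hC.
  - by move=> F hF; rewrite preimage_bigcup; exact: hU.
apply: sub_gen_smallest => X /oU[t t0 ht].
by have [s s0 hs] := mmscale_continuous a b X t0; exists s => // Y /hs/ht.
Qed.

Lemma mm_le_scale (R : realType) (a b a' b' : {posnum R}) (X X' : mmspace R) :
  a%:num <= a'%:num -> b%:num <= b'%:num -> mm_le X X' ->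
  mm_le (mmscale a b X) (mmscale a' b' X').
Proof.
move=> aa bb [phi [phis phi1 phim]]; have [d0 _ _ _] := mm_metric X.
exists phi; split => //= [x y|A].
  by apply: ler_pM => //; exact: ltW.
rewrite dborel_scale // => hA; apply: ler_pM => //; [|exact: phim].
exact: mm_mu_ge0.
Qed.

Lemma mm_le_scale2 (R : realType) (a b a' b' l : {posnum R}) (X : mmspace R) :
  a%:num <= l%:num * a'%:num -> b%:num <= l%:num * b'%:num ->
  mm_le (mmscale a b X) (mmscale l l (mmscale a' b' X)).
Proof.
move=> aa bb; have [d0 _ _ _] := mm_metric X.
exists id; split => //= [y|x y|A]; first by exists y.
  by rewrite mulrA ler_wpM2r.
rewrite dborel_scale // => hA; rewrite mulrA ler_wpM2r //.
exact: mm_mu_ge0.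
Qed.

Lemma mm_le_scale2' (R : realType) (a b a' b' l : {posnum R}) (X : mmspace R) :
  l%:num * a'%:num <= a%:num -> l%:num * b'%:num <= b%:num ->
  mm_le (mmscale l l (mmscale a' b' X)) (mmscale a b X).
Proof.
move=> aa bb; have [d0 _ _ _] := mm_metric X.
exists id; split => //= [y|x y|A]; first by exists y.
  by rewrite mulrA ler_wpM2r.
rewrite !dborel_scale // => hA; rewrite mulrA ler_wpM2r //.
exact: mm_mu_ge0.
Qed.

Lemma GHP_continuous_scale1 (R : realType) (f : mmspace R -> R) (X : mmspace R)
  (l : nat -> {posnum R}) : GHP_continuous f ->
  (fun n => (l n)%:num : R) @ \oo --> (1 : R) ->
  (fun n => f (mmscale (l n) (l n) X)) @ \oo --> f X.
Proof.
move=> fc l1; apply/cvgrPdist_lt => e /(fc X)[t t0 ht].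
have [r r0 hr] := dom_antisym X t0.
have [s s0 hs] := dom_scale_near1 X r0.
move/cvgrPdist_le : l1 => /(_ s s0); apply: filterS => n; rewrite distrC => ln.
by apply: ht; have [h1 h2] := hs _ _ ln ln; exact: hr.
Qed.

Lemma GHP_open_gt (R : realType) (f : mmspace R -> R) (c : R) :
  GHP_continuous f -> GHPopen [set X | c < f X].
Proof.
move=> fc X /= cf; have [|t t0 ht] := fc X (f X - c); first by rewrite subr_gt0.
by exists t => // Y /ht; rewrite ltr_norml => /andP[_]; lra.
Qed.

Lemma GHPborel_gt (R : realType) (f : mmspace R -> R) (c : R) :
  GHP_continuous f -> GHPborel [set X | c < f X].
Proof. by move=> fc; apply: sub_gen_smallest; exact: GHP_open_gt. Qed.

Lemma GHP_random_measurable (R : realType) (dO : measure_display)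
  (Omega : measurableType dO) (Y : Omega -> mmspace R) (f : mmspace R -> R) :
  GHP_random Y -> GHP_continuous f -> measurable_fun setT (fun w => f (Y w)).
Proof.
move=> mY fc; apply: (measurability _ (RGenOInfty.measurableE R)) => //.
move=> _ [_ [c ->] <-]; rewrite setTI.
rewrite (_ : _ @^-1` _ = Y @^-1` [set X | c < f X]); first by apply: mY; exact: GHPborel_gt.
by apply/seteqP; split => w /=; rewrite in_itv /= andbT.
Qed.

(** At scale [1 / (j + 1)] each realised code keeps one space that has it; [X0] merely fills the
    unrealised ones. The factor 5 is that of [has_code_dom]. *)
Lemma ghp_code_centers (R : realType) (X0 : mmspace R) :
  exists W : nat -> nat -> mmspace R, forall j X,
    exists k, domq X (W j k) <= 5 * j.+1%:R^-1 /\ domq (W j k) X <= 5 * j.+1%:R^-1.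
Proof.
have pick (jk : nat * nat) : exists W : mmspace R, forall c : ghp_code,
    unpickle jk.2 = Some c -> (exists X : mmspace R, has_code jk.1.+1%:R^-1 c X) ->
    has_code jk.1.+1%:R^-1 c W.
  case: (unpickle jk.2) => [c|]; last by exists X0.
  have [[X hX]|nX] := pselect (exists X : mmspace R, has_code jk.1.+1%:R^-1 c X).
    by exists X => _ [<-].
  by exists X0 => _ [<-].
have [W hW] := choice pick; exists (fun j k => W (j, k)) => j X.
have j0 : 0 < j.+1%:R^-1 :> R by rewrite invr_gt0.
have [c hc] := has_code_ex X j0; exists (pickle c).
have := hW (j, pickle c) c (pickleK c) (ex_intro _ X hc) => {}hW.
by split; apply: domq_le; rewrite ?mulr_ge0 ?ltW //; apply: has_code_dom j0 _ _; eassumption.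
Qed.

(** * Means and tails *)

Lemma integrable_bdd (R : realType) (dO : measure_display) (Omega : measurableType dO)
  (P : probability Omega R) (h : Omega -> R) (M : R) :
  measurable_fun setT h -> (forall w, `|h w| <= M) -> P.-integrable setT (EFin \o h).
Proof.
move=> mh hM; apply: measurable_bounded_integrable => //.
  by apply: le_lt_trans (probability_le1 P measurableT) _; rewrite ltry.
exists M; split; first exact: num_real.
by move=> M' /ltW MM' w _; exact: le_trans (hM w) MM'.
Qed.

Lemma integrable01 (R : realType) (dO : measure_display) (Omega : measurableType dO)
  (P : probability Omega R) (h : Omega -> R) :
  measurable_fun setT h -> (forall w, 0 <= h w <= 1) -> P.-integrable setT (EFin \o h).
Proof.
move=> mh h01; apply: (integrable_bdd P (M := 1)) => // w.
by have /andP[h0 h1] := h01 w; rewrite ger0_norm.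
Qed.

Lemma EFin_mean (R : realType) (dO : measure_display) (Omega : measurableType dO)
  (P : probability Omega R) (h : Omega -> R) : P.-integrable setT (EFin \o h) ->
  (\int[P]_w (h w)%:E)%E = (\int[P]_w h w)%:E.
Proof. by move=> ih; rewrite /Rintegral fineK //; exact: integrable_fin_num. Qed.

Definition pr (R : realType) (dO : measure_display) (Omega : measurableType dO)
  (P : probability Omega R) (A : set Omega) : R := fine (P A).

Lemma EFin_pr (R : realType) (dO : measure_display) (Omega : measurableType dO)
  (P : probability Omega R) (A : set Omega) : measurable A -> (pr P A)%:E = P A.
Proof. by move=> mA; rewrite fineK // fin_num_measure. Qed.

Lemma pr_ge0 (R : realType) (dO : measure_display) (Omega : measurableType dO)
  (P : probability Omega R) (A : set Omega) : 0 <= pr P A.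
Proof. by rewrite fine_ge0. Qed.

Lemma pr_le1 (R : realType) (dO : measure_display) (Omega : measurableType dO)
  (P : probability Omega R) (A : set Omega) : measurable A -> pr P A <= 1.
Proof. by move=> mA; rewrite -lee_fin EFin_pr // probability_le1. Qed.

Lemma pr_le (R : realType) (dO : measure_display) (Omega : measurableType dO)
  (P : probability Omega R) (A B : set Omega) : measurable A -> measurable B ->
  A `<=` B -> pr P A <= pr P B.
Proof. by move=> mA mB AB; rewrite -lee_fin !EFin_pr // le_measure // inE. Qed.

Lemma prC (R : realType) (dO : measure_display) (Omega : measurableType dO)
  (P : probability Omega R) (A : set Omega) : measurable A -> pr P (~` A) = 1 - pr P A.
Proof.
move=> mA; apply: EFin_inj; rewrite EFinB !EFin_pr //; last exact: measurableC.
exact: probability_setC.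
Qed.

Lemma mean_sum_indic (R : realType) (dO : measure_display) (Omega : measurableType dO)
  (P : probability Omega R) (K : nat) (A : 'I_K -> set Omega) :
  (forall i, measurable (A i)) ->
  \int[P]_w (\sum_(i < K) \1_(A i) w) = \sum_(i < K) pr P (A i).
Proof.
move=> mA; apply: EFin_inj; rewrite -EFin_mean; last first.
  apply: (integrable_bdd P (M := K%:R)).
    by apply: measurable_sum => i; exact: measurable_indic.
  move=> w; apply: (le_trans (ler_norm_sum _ _ _)).
  rewrite -[X in _ <= X%:R]card_ord -sumr_const; apply: ler_sum => i _.
  by rewrite indicE normr_nat lern1 leq_b1.
under eq_integral do rewrite -sumEFin.
rewrite ge0_integral_sum //; last by move=> i; apply/measurable_EFinP/measurable_indic.
rewrite -sumEFin; apply: eq_bigr => i _.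
by rewrite integral_indic // setIT EFin_pr.
Qed.

(** The sum counts the integers from 1 to [K] strictly below [y]. At an integer [y] the count is
    [y - 1], hence the loss of 1; the upper bound on [y] may therefore be [K + 1]. *)
Lemma count_lt_bounds (R : realType) (K : nat) (y : R) : 0 <= y ->
  \sum_(i < K) (i.+1%:R < y)%R%:R <= y /\
  (y <= K.+1%:R -> y <= \sum_(i < K) (i.+1%:R < y)%R%:R + 1).
Proof.
move=> y0; have mono k : \sum_(i < k) (i.+1%:R < y)%R%:R <= k%:R :> R.
  rewrite -[X in _ <= X%:R]card_ord -sumr_const; apply: ler_sum => i _.
  by rewrite lern1 leq_b1.
split; elim: K => [|K IH].
- by rewrite big_ord0.
- have [yK|Ky] := leP y K.+1%:R.
    by rewrite big_ord_recr /= ltNge yK addr0.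
  exact: le_trans (mono _) (ltW Ky).
- by rewrite big_ord0 add0r.
- move=> yK; have [yK'|Ky] := leP y K.+1%:R.
    by apply: le_trans (IH yK') _; rewrite big_ord_recr /= lerD2r lerDl ler0n.
  rewrite (eq_bigr (fun=> 1)) => [|i _]; first by rewrite sumr_const card_ord natr1.
  by rewrite (le_lt_trans _ Ky) // ler_nat.
Qed.

(** A Riemann sum for the tail formula of the mean: pointwise, the number of levels [i / K] below
    [U] is within 1 of [K * U]. *)
Lemma layer_cake (R : realType) (dO : measure_display) (Omega : measurableType dO)
  (P : probability Omega R) (U : Omega -> R) (K : nat) : (0 < K)%N ->
  measurable_fun setT U -> (forall w, 0 <= U w <= 1) ->
  let S := (\sum_(i < K) pr P [set w | i.+1%:R / K%:R < U w]) / K%:R in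
  S <= \int[P]_w U w /\ \int[P]_w U w <= S + K%:R^-1.
Proof.
move=> K0 mU U01 S; have KR : 0 < K%:R :> R by rewrite ltr0n.
have mA (i : 'I_K) : measurable [set w | i.+1%:R / K%:R < U w].
  have := measurable_fun_ltr (measurable_cst (i.+1%:R / K%:R : R)) mU.
  by move=> /(_ measurableT [set true] I); rewrite setTI.
pose cnt w := \sum_(i < K) \1_[set w | i.+1%:R / K%:R < U w] w : R.
have mcnt : measurable_fun setT cnt by apply: measurable_sum => i; exact: measurable_indic.
have cntE w : cnt w = \sum_(i < K) (i.+1%:R < K%:R * U w)%R%:R.
  apply: eq_bigr => i _; rewrite indicE; congr (nat_of_bool _)%:R.
  by apply/idP/idP; rewrite inE /= ltr_pdivrMr // mulrC.
have KU w : 0 <= K%:R * U w by have /andP[? _] := U01 w; rewrite mulr_ge0.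
have c1 w : cnt w <= K%:R * U w by rewrite cntE; have [] := count_lt_bounds K (KU w).
have c2 w : K%:R * U w <= cnt w + 1.
  rewrite cntE; have [_] := count_lt_bounds K (KU w); apply.
  have /andP[_ u1] := U01 w; apply: (@le_trans _ _ K%:R); last by rewrite ler_nat.
  by rewrite ler_piMr.
have cb w : `|cnt w| <= K%:R.
  rewrite ger0_norm; last by rewrite sumr_ge0 // => i _; rewrite indicE.
  by apply: (le_trans (c1 w)); rewrite ler_piMr //; have /andP[] := U01 w.
have icnt := integrable_bdd P mcnt cb; have iU := integrable01 P mU U01.
have iKU : P.-integrable setT (EFin \o (fun w => K%:R * U w)).
  apply: (integrable_bdd P (M := K%:R)); first exact: measurable_funM.
  by move=> w; rewrite ger0_norm // ler_piMr //; have /andP[] := U01 w.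
have i1 : P.-integrable setT (EFin \o (fun=> 1 : R)).
  by apply: integrable01 => // w; rewrite ler01 lexx.
have ic1 : P.-integrable setT (EFin \o (fun w => cnt w + 1)).
  by have := integrableD measurableT icnt i1.
have Scnt : \int[P]_w cnt w = K%:R * S.
  by rewrite /cnt mean_sum_indic // /S mulrC divfK // gt_eqF.
have := le_Rintegral measurableT icnt iKU (fun w _ => c1 w).
have := le_Rintegral measurableT iKU ic1 (fun w _ => c2 w).
rewrite RintegralZl // RintegralD // Rintegral_cst // mul1r.
rewrite [fine _](_ : _ = 1) ?Scnt; last exact: (congr1 fine (probability_setT P)).
rewrite ler_pM2l // => h1 ->; split => //.
by rewrite -(ler_pM2l KR) mulrDr divff // gt_eqF.
Qed.

(** A tail error uniform in the level is averaged over the [K] levels, so it enters the mean once;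
    the discretisation error [1 / K] is then sent to 0. *)
Lemma mean_le_tail (R : realType) (dO : measure_display) (Omega : measurableType dO)
  (P : probability Omega R) (U V : Omega -> R) (e : R) :
  measurable_fun setT U -> (forall w, 0 <= U w <= 1) ->
  measurable_fun setT V -> (forall w, 0 <= V w <= 1) ->
  (forall t, pr P [set w | t < U w] <= pr P [set w | t < V w] + e) ->
  \int[P]_w U w <= \int[P]_w V w + e.
Proof.
move=> mU U01 mV V01 h; apply/ler_addgt0Pr => x x0.
pose K := (Num.truncn x^-1).+1.
have K0 : 0 < K%:R :> R by rewrite ltr0n.
have Kx : K%:R^-1 <= x.
  by rewrite invf_ple // ?posrE //; apply/ltW; rewrite /K truncnS_gt.
have [_] := @layer_cake _ _ _ P U K isT mU U01.
have [+ _] := @layer_cake _ _ _ P V K isT mV V01.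
suff : (\sum_(i < K) pr P [set w | i.+1%:R / K%:R < U w]) / K%:R <=
    (\sum_(i < K) pr P [set w | i.+1%:R / K%:R < V w]) / K%:R + e by lra.
rewrite ler_pdivrMr // mulrDl divfK ?gt_eqF // mulr_natr.
rewrite -[X in e *+ X]card_ord -sumr_const -big_split /=.
exact: ler_sum.
Qed.

(** The rank from which a tail inequality holds may depend on the level. Half of [e] pays for
    restricting to finitely many levels, which share a rank, and half for the tails. *)
Lemma mean_liminf_tail (R : realType) (dO : measure_display)
  (Omega : measurableType dO) (P : probability Omega R) (U : nat -> Omega -> R)
  (V : Omega -> R) :
  (\forall n \near \oo, measurable_fun setT (U n)) -> (forall n w, 0 <= U n w <= 1) ->
  measurable_fun setT V -> (forall w, 0 <= V w <= 1) ->
  (forall t e : R, 0 < e -> \forall n \near \oo,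
     pr P [set w | t < V w] <= pr P [set w | t < U n w] + e) ->
  forall e : R, 0 < e -> \forall n \near \oo, \int[P]_w V w <= \int[P]_w U n w + e.
Proof.
move=> mU U01 mV V01 h e e0.
pose K := (Num.truncn (e / 2)^-1).+1.
have K0 : 0 < K%:R :> R by rewrite ltr0n.
have Kx : K%:R^-1 <= e / 2.
  have e2 : 0 < (e / 2)^-1 by rewrite invr_gt0 divr_gt0.
  by rewrite invf_ple ?posrE ?divr_gt0 //; apply/ltW; rewrite /K truncnS_gt.
have e2 : 0 < e / 2 by lra.
have hK := filter_forall _ (fun i : 'I_K => h (i.+1%:R / K%:R) (e / 2) e2).
near=> n; have mUn : measurable_fun setT (U n) by near: n.
have hn (i : 'I_K) : pr P [set w | i.+1%:R / K%:R < V w] <=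
    pr P [set w | i.+1%:R / K%:R < U n w] + e / 2 by move: i; near: n; exact: hK.
have [_] := @layer_cake _ _ _ P V K isT mV V01.
have [+ _] := @layer_cake _ _ _ P (U n) K isT mUn (U01 n).
suff : (\sum_(i < K) pr P [set w | i.+1%:R / K%:R < V w]) / K%:R <=
    (\sum_(i < K) pr P [set w | i.+1%:R / K%:R < U n w]) / K%:R + e / 2 by lra.
rewrite ler_pdivrMr // mulrDl divfK ?gt_eqF // mulr_natr.
rewrite -[X in (e / 2) *+ X]card_ord -sumr_const -big_split /=.
by apply: ler_sum => i _; exact: hn.
Unshelve. all: by end_near.
Qed.

(* Conditioning on the value of a random index [N] independent of the events. *)
Lemma pr_random_index (R : realType) (dO : measure_display)
  (Omega : measurableType dO) (P : probability Omega R) (N : Omega -> nat)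
  (E : nat -> set Omega) (S : pred nat) (q : R) :
  (forall k, measurable [set w | N w = k]) ->
  (forall k, S k -> measurable (E k)) ->
  (forall k, S k -> P ([set w | N w = k] `&` E k) = (P [set w | N w = k] * P (E k))%E) ->
  measurable [set w | E (N w) w] -> 0 <= q <= 1 ->
  (forall k, S k -> q <= pr P (E k)) ->
  q <= pr P [set w | E (N w) w] + pr P [set w | ~~ S (N w)].
Proof.
move=> mN mE ind mEN /andP[q0 q1] hq.
have mS (T : pred nat) : measurable [set w | T (N w)].
  rewrite (_ : [set w | _] = \bigcup_(k in [set k | T k]) [set w | N w = k]).
    by apply: bigcup_measurable => k _; exact: mN.
  by apply/seteqP; split => w /= => [Tw|[k Tk ->]//]; exists (N w).
have tr (F : nat -> set Omega) :
    trivIset [set` S] (fun k => [set w | N w = k] `&` F k).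
  by move=> i j _ _ [w [[/= <- _] [/= <- _]]].
have PS : P [set w | S (N w)] = (\sum_(0 <= k <oo | S k) P [set w | N w = k])%E.
  rewrite (_ : [set w | _] = \bigcup_(k in [set` S]) ([set w | N w = k] `&` setT)).
    rewrite measure_bigcup //; last by move=> k _; rewrite setIT; exact: mN.
    rewrite (@eq_eseriesl _ _ S) => [|k]; last by rewrite mem_setE.
    by apply: eq_eseriesr => k; rewrite setIT.
  by apply/seteqP; split => w /= => [Tw|[k Tk [-> _]]//]; exists (N w).
have h1 : (q%:E * P [set w | S (N w)] <= P [set w | E (N w) w])%E.
  apply: (@le_trans _ _ (P (\bigcup_(k in [set` S]) ([set w | N w = k] `&` E k)))).
    rewrite measure_bigcup //; last by move=> k Sk; apply: measurableI; [exact: mN|exact: mE].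
    rewrite PS -nneseriesZl //.
    rewrite [leRHS](@eq_eseriesl _ _ S) => [|k]; last by rewrite mem_setE.
    apply: lee_nneseries => k; first by move=> _ _; rewrite mule_ge0 // lee_fin.
    move=> Sk; apply: (@le_trans _ _ (P [set w | N w = k] * P (E k))%E).
      rewrite muleC lee_wpmul2l //.
      by rewrite -(EFin_pr P (mE _ Sk)) lee_fin; exact: hq.
    by rewrite -(ind _ Sk).
  apply: le_measure; rewrite ?inE //.
    by apply: bigcup_measurable => k Sk; apply: measurableI; [exact: mN|exact: mE].
  by move=> w [k Sk [/= -> ?]].
have SC : [set w | ~~ S (N w)] = ~` [set w | S (N w)].
  by apply/seteqP; split => w /= /negP.
rewrite SC prC //; move: h1; rewrite -(EFin_pr P mEN) -(EFin_pr P (mS S)) -EFinM lee_fin.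
have := pr_le1 P (mS S); have := pr_ge0 P [set w | S (N w)].
set s := pr P _ => s0 s1 h1.
(* Write [q] as [q * s + q * (1 - s)]: the first term is at most the probability of the event by
   [h1], the second at most that of [N] outside [S]. *)
have : q * (1 - s) <= 1 - s by rewrite ler_piMl // subr_ge0.
lra.
Qed.

(** * Random indices and tame scalings *)

(** If no [t] worked, there would be bad pairs with [n] arbitrarily large and [k / n] arbitrarily
    small. Assembled into one function [k], they form an [o(n)] perturbation that contradicts
    tameness. *)
Lemma tame_uniform (R : realType) (x : nat -> R) (e : R) : tame x -> 0 < e ->
  exists2 t : R, 0 < t & exists n0, forall n k, (n0 <= n)%N -> k%:R <= t * n%:R ->
    `|x (n + k)%N / x n - 1| <= e.
Proof.
move=> tx e0; apply: contrapT => H.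
have bad (j : nat) : exists nk : nat * nat, [/\ (j < nk.1)%N,
    nk.2%:R <= j.+1%:R^-1 * nk.1%:R :> R & e < `|x (nk.1 + nk.2)%N / x nk.1 - 1|].
  apply: contrapT => nb; apply: H; exists j.+1%:R^-1; first by rewrite invr_gt0.
  exists j.+1 => n k jn kn; rewrite leNgt; apply/negP => ek; apply: nb.
  by exists (n, k).
have [nk hnk] := choice bad.
(* Several bad pairs may share their first component; one is selected, and [k] is 0 where there is
   none. *)
have sel (n : nat) : exists k : nat, (exists2 j, (nk j).1 = n & (nk j).2 = k) \/
    ((forall j, (nk j).1 <> n) /\ k = 0%N).
  have [[j jn]|nj] := pselect (exists j, (nk j).1 = n).
    by exists (nk j).2; left; exists j.
  by exists 0%N; right; split => // j jn; apply: nj; exists j.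
have [k hk] := choice sel.
have k0 : (fun n => (k n)%:R / n%:R : R) @ \oo --> (0 : R).
  apply/cvgrPdist_le => d d0; pose J := Num.truncn d^-1.
  exists (\max_(j < J.+1) (nk j).1).+1 => // n /= Jn.
  have n0 : 0 < n%:R :> R by rewrite ltr0n (leq_ltn_trans _ Jn).
  rewrite sub0r normrN ger0_norm ?divr_ge0 // ler_pdivrMr //.
  have [[j jn <-]|[_ ->]] := hk n; last by rewrite mulr_ge0 // ltW.
  have [_ + _] := hnk j; rewrite jn => /le_trans; apply; rewrite ler_pM2r //.
  have Jj : (J < j)%N.
    rewrite ltnNge; apply/negP => jJ; move: Jn; rewrite ltnNge -jn => /negP; apply.
    exact: (leq_bigmax (Ordinal (jJ : (j < J.+1)%N))).
  rewrite invf_ple ?posrE // ?invr_gt0 //; apply: (le_trans (ltW (truncnS_gt _))).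
  by rewrite ler_nat; exact: leq_trans Jj _.
have /cvgrPdist_lt/(_ e e0)[n0 _ hn0] := tx _ k0.
have [j0n _ _] := hnk n0; have := hn0 (nk n0).1 (ltnW j0n); rewrite /= distrC.
(* The pair selected at this index may differ from the pair of rank [n0], but it is bad as well. *)
have [[j jn <-]|[/(_ n0)//]] := hk (nk n0).1.
by have [_ _] := hnk j; rewrite jn => /lt_trans h /h; rewrite ltxx.
Qed.

Lemma tame_ratio (R : realType) (x : nat -> {posnum R}) (l : R) :
  tame (fun n => (x n)%:num) -> 1 < l ->
  exists2 t : R, 0 < t & exists n0, forall n k, (n0 <= n)%N -> k%:R <= t * n%:R ->
    (x (n + k)%N)%:num <= l * (x n)%:num /\ (x n)%:num <= l * (x (n + k)%N)%:num.
Proof.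
move=> tx l1; have l0 : 0 < l by lra.
(* This tolerance gives the ratio the lower bound [l^-1], and the upper bound [l] because
   [1 - l^-1 <= l - 1]. *)
have e0 : 0 < 1 - l^-1 by rewrite subr_gt0 invf_lt1.
have [t t0 [n0 h]] := tame_uniform tx e0; exists t => //; exists n0 => n k n0n kt.
have := h n k n0n kt; rewrite ler_norml => /andP[h1 h2].
have il : l^-1 * l = 1 by rewrite mulVf // gt_eqF.
have ll : 1 - l^-1 <= l - 1.
  rewrite -(ler_pM2r l0) mulrBl il; have := sqr_ge0 (l - 1); rewrite expr2; lra.
split.
  by rewrite -ler_pdivrMr //; lra.
have : l^-1 <= (x (n + k)%N)%:num / (x n)%:num by lra.
rewrite ler_pdivlMr // => h3; have := ler_wpM2l (ltW l0) h3.
by rewrite mulrA divff ?mul1r // gt_eqF.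
Qed.

Lemma GHPborelC (R : realType) (B : set (mmspace R)) : GHPborel B -> GHPborel (~` B).
Proof.
have [_ hC _] := smallest_sigma_algebra [set: mmspace R] (@GHPopen R).
by move=> /hC; rewrite setTD.
Qed.

Lemma GHP_random_index (R : realType) (dO : measure_display)
  (Omega : measurableType dO) (X : nat -> Omega -> mmspace R) (N : Omega -> nat) :
  (forall k, (1 <= k)%N -> GHP_random (X k)) ->
  (forall k, measurable [set w | N w = k]) -> (forall w, (1 <= N w)%N) ->
  GHP_random (fun w => X (N w) w).
Proof.
move=> mX mN N1 B hB.
rewrite (_ : _ @^-1` _ = \bigcup_(k in [set k | (1 <= k)%N])
    ([set w | N w = k] `&` X k @^-1` B)).
  by apply: bigcup_measurable => k k1; apply: measurableI; [exact: mN|exact: mX k k1 B hB].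
by apply/seteqP; split => w /= => [Bw|[k _ [<-]//]]; exists (N w) => //; exact: N1.
Qed.

Lemma random_index_compare (R : realType) (dO : measure_display)
  (Omega : measurableType dO) (P : probability Omega R)
  (X : nat -> Omega -> mmspace R) (N : Omega -> nat) (n : nat) (p : mmspace R -> R) :
  (forall k, (1 <= k)%N -> GHP_random (X k)) ->
  (forall k, measurable [set w | N w = k]) -> (forall w, (1 <= N w)%N) ->
  (forall k B, (1 <= k)%N -> GHPborel B ->
    P ([set w | N w = k] `&` X k @^-1` B) = (P [set w | N w = k] * P (X k @^-1` B))%E) ->
  (forall k l, (1 <= k)%N -> (k <= l)%N -> stoch_le P (X k) (X l)) ->
  (1 <= n)%N -> test_fun p ->
  \int[P]_w p (X n w) <= \int[P]_w p (X (N w) w) + pr P [set w | (N w < n)%N] /\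
  \int[P]_w p (X (N w) w) <= \int[P]_w p (X n w) + pr P [set w | (n < N w)%N].
Proof.
move=> mX mN N1 ind mono n1 [[pc p01] pm].
have mXN := GHP_random_index mX mN N1.
have mpX := GHP_random_measurable (mX n n1) pc.
have mpN := GHP_random_measurable mXN pc.
have bor t := GHPborel_gt t pc.
have pr_mono t k l : (1 <= k)%N -> (k <= l)%N ->
    pr P [set w | t < p (X k w)] <= pr P [set w | t < p (X l w)].
  move=> k1 kl; rewrite -lee_fin !EFin_pr; last 2 first.
  - exact: (mX l (leq_trans k1 kl) _ (bor t)).
  - exact: (mX k k1 _ (bor t)).
  apply: (mono k l k1 kl) (bor t) _ => Y Y' /= tY /pm; exact: lt_le_trans.
split; apply: mean_le_tail => // t.
- have := @pr_random_index _ _ _ P N (fun k => X k @^-1` [set Y | t < p Y])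
    (fun k => (n <= k)%N) (pr P [set w | t < p (X n w)]).
  rewrite (_ : [set w | ~~ (n <= N w)%N] = [set w | (N w < n)%N]); last first.
    by apply/seteqP; split => w /=; rewrite ltnNge.
  apply => //.
  + by move=> k nk; exact: (mX k (leq_trans n1 nk) _ (bor t)).
  + by move=> k nk; exact: (ind k _ (leq_trans n1 nk) (bor t)).
  + exact: (mXN _ (bor t)).
  + by rewrite pr_ge0 pr_le1 //; exact: (mX n n1 _ (bor t)).
  + by move=> k nk; exact: pr_mono.
(* [pr_random_index] bounds probabilities from below only, so the upper bound is obtained from the
   complementary events. *)
- have := @pr_random_index _ _ _ P N (fun k => X k @^-1` (~` [set Y | t < p Y]))
    (fun k => (1 <= k <= n)%N) (1 - pr P [set w | t < p (X n w)]).
  rewrite (_ : [set w | ~~ (1 <= N w <= n)%N] = [set w | (n < N w)%N]); last first.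
    by apply/seteqP; split => w /=; rewrite N1 -ltnNge.
  rewrite (_ : [set w | _] = ~` [set w | t < p (X (N w) w)]) // prC; last exact: (mXN _ (bor t)).
  have q01 : 0 <= 1 - pr P [set w | t < p (X n w)] <= 1.
    rewrite subr_ge0 lerBlDr lerDl pr_ge0 pr_le1 //; exact: (mX n n1 _ (bor t)).
  have h : forall k, (1 <= k <= n)%N ->
      1 - pr P [set w | t < p (X n w)] <= pr P (X k @^-1` (~` [set Y | t < p Y])).
    move=> k /andP[k1 kn]; rewrite preimage_setC prC; last exact: (mX k k1 _ (bor t)).
    by rewrite lerD2l lerN2; exact: pr_mono.
  move=> /(_ mN _ _ _ q01 h) H; suff : 1 - pr P [set w | t < p (X n w)] <=
    1 - pr P [set w | t < p (X (N w) w)] + pr P [set w | (n < N w)%N] by lra.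
  apply: H.
  + by move=> k /andP[k1 _]; exact: (mX k k1 _ (GHPborelC (bor t))).
  + by move=> k /andP[k1 _]; exact: (ind k _ k1 (GHPborelC (bor t))).
  + exact: (mXN _ (GHPborelC (bor t))).
Qed.

Lemma mean_scale1 (R : realType) (dO : measure_display) (Omega : measurableType dO)
  (P : probability Omega R) (Y : Omega -> mmspace R) (f : mmspace R -> R)
  (l : nat -> {posnum R}) : GHP_random Y -> continuous01 f ->
  (fun n => (l n)%:num : R) @ \oo --> (1 : R) ->
  (fun n => \int[P]_w f (mmscale (l n) (l n) (Y w))) @ \oo --> \int[P]_w f (Y w).
Proof.
move=> mY [fc f01] l1; have mf := GHP_random_measurable mY fc.
have mfl n := GHP_random_measurable mY (GHP_continuous_scale (l n) (l n) fc).
have i1 : P.-integrable setT (EFin \o (fun=> 1 : R)).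
  by apply: integrable01 => // w; rewrite ler01 lexx.
have [|||||_ _] := @dominated_convergence _ _ _ P _ measurableT
  (fun n w => (f (mmscale (l n) (l n) (Y w)))%:E) (fun w => (f (Y w))%:E) (fun=> 1%E).
- by move=> n; apply/measurable_EFinP; exact: mfl.
- exact/measurable_EFinP.
- apply: aeW => w _; apply: cvg_EFin; first exact: nearW.
  exact: GHP_continuous_scale1.
- by [].
- apply: aeW => w n _; rewrite /= lee_fin.
  by have /andP[? ?] := f01 (mmscale (l n) (l n) (Y w)); rewrite ger0_norm.
by rewrite EFin_mean; [move=> /fine_cvgP[]|exact: integrable01].
Qed.

Lemma conv_distr_mean (R : realType) (dO : measure_display) (Omega : measurableType dO)
  (P : probability Omega R) (Y : nat -> Omega -> mmspace R) (Yinf : Omega -> mmspace R)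
  (f : mmspace R -> R) (e : R) :
  GHP_random Yinf -> conv_distr P Y Yinf -> continuous01 f -> 0 < e ->
  \forall n \near \oo, `|\int[P]_w f (Y n w) - \int[P]_w f (Yinf w)| <= e.
Proof.
move=> mY cv [fc f01] e0; have fb : GHP_bounded f.
  by exists 1 => Z; have /andP[? ?] := f01 Z; rewrite ger0_norm.
have := cv f fb fc; rewrite EFin_mean; last first.
  by apply: integrable01 => //; exact: GHP_random_measurable.
move=> /fine_cvgP[_] /cvgrPdist_le/(_ e e0); apply: filterS => n.
by rewrite distrC.
Qed.

Lemma test_fun_scale (R : realType) (a b : {posnum R}) (p : mmspace R -> R) :
  test_fun p -> test_fun (fun X => p (mmscale a b X)).
Proof.
move=> [[pc p01] pm]; split; first by split => //; exact: GHP_continuous_scale.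
by move=> X X' XX'; apply: pm; exact: mm_le_scale.
Qed.

(** Both inverse factors come from [1 + 1 / (n + 1)] at one large [n]: [l] enlarges for the upper
    half of the squeeze, [m] shrinks for the lower half. *)
Lemma scale_approx (R : realType) (dO : measure_display) (Omega : measurableType dO)
  (P : probability Omega R) (Y : Omega -> mmspace R) (f : mmspace R -> R) (e : R) :
  GHP_random Y -> continuous01 f -> 0 < e -> exists l m : {posnum R},
    [/\ 1 < l%:num, m%:num * l%:num = 1,
        \int[P]_w f (mmscale l l (Y w)) <= \int[P]_w f (Y w) + e &
        \int[P]_w f (Y w) <= \int[P]_w f (mmscale m m (Y w)) + e].
Proof.
move=> mY f01 e0; have l0 (n : nat) : 0 < 1 + n.+1%:R^-1 :> R by rewrite addr_gt0 ?invr_gt0.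
have m0 (n : nat) : 0 < (1 + n.+1%:R^-1)^-1 :> R by rewrite invr_gt0.
pose l n := PosNum (l0 n); pose m n := PosNum (m0 n).
have l1 : (fun n => (l n)%:num : R) @ \oo --> (1 : R).
  rewrite -[X in _ --> X]addr0; apply: cvgD; [exact: cvg_cst|exact: cvg_harmonic].
have m1 : (fun n => (m n)%:num : R) @ \oo --> (1 : R).
  by rewrite -[X in _ --> X]invr1; apply: cvgV => //; exact: oner_neq0.
have /cvgrPdist_le/(_ e e0) hl := mean_scale1 (P := P) mY f01 l1.
have /cvgrPdist_le/(_ e e0) hm := mean_scale1 (P := P) mY f01 m1.
have [n _ /(_ n (leqnn n))[]] := filterI hl hm.
rewrite /= !ler_distl => /andP[h1 h2] /andP[h3 h4].
exists (l n), (m n); split; [by rewrite /= ltrDl invr_gt0|by rewrite /= mulVf // gt_eqF| |].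
- by move: h1 h2; rewrite /=; lra.
- by move: h3 h4; rewrite /=; lra.
Qed.

(* [X n] is squeezed between [X (N m)] for [m] slightly below and slightly above [n];
   monotonicity of [p] absorbs the ratio of the scaling constants into [l]. *)
Lemma mean_test_cvg (R : realType) (dO : measure_display) (Omega : measurableType dO)
  (P : probability Omega R) (X : nat -> Omega -> mmspace R) (Xinf : Omega -> mmspace R)
  (N : nat -> Omega -> nat) (a b : nat -> {posnum R}) (p : mmspace R -> R) (e : R) :
  (forall n, (1 <= n)%N -> GHP_random (X n)) -> GHP_random Xinf ->
  (forall n k, (1 <= n)%N -> measurable [set w | N n w = k]) ->
  (forall n w, (1 <= n)%N -> (1 <= N n w)%N) ->
  tame (fun n => (a n)%:num) -> tame (fun n => (b n)%:num) ->
  (forall n m q, (1 <= n)%N -> (1 <= m)%N -> test_fun q ->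
    \int[P]_w q (X n w) <= \int[P]_w q (X (N m w) w) + pr P [set w | (N m w < n)%N] /\
    \int[P]_w q (X (N m w) w) <= \int[P]_w q (X n w) + pr P [set w | (n < N m w)%N]) ->
  conv_distr P (fun n w => mmscale (a n) (b n) (X (N n w) w)) Xinf ->
  (forall e : R, 0 < e ->
     P [set w | e < `|(N n w)%:R / n%:R - 1|] @[n --> \oo] --> 0%E) ->
  test_fun p -> 0 < e ->
  \forall n \near \oo,
    `|\int[P]_w p (mmscale (a n) (b n) (X n w)) - \int[P]_w p (Xinf w)| <= e.
Proof.
move=> mX mXi mN N1 ta tb cmp cv cN tp e0; have [[pc p01] pm] := tp.
have e3 : 0 < e / 3 by lra.
have [l [m [l1 ml hl hm]]] := scale_approx P mXi (proj1 tp) e3.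
have m0 : 0 < m%:num by [].
have [ta0 ta00 [na hta]] := tame_ratio ta l1.
have [tb0 tb00 [nb htb]] := tame_ratio tb l1.
pose t := Num.min 1 (Num.min ta0 tb0).
have t0 : 0 < t by rewrite !lt_min ltr01 ta00 tb00.
have [t1 tta ttb] : [/\ t <= 1, t <= ta0 & t <= tb0].
  by rewrite /t !ge_min !lexx !orbT.
(* For large [n] the shift [k] exceeds [t n / 4] while [n - k] and [n + k] are at most [3 n / 2]. An
   index [N i] on the wrong side of [n] thus deviates from [i] by a proportion above [t / 6], hence
   above [t / 8]. *)
have t8 : 0 < t / 8 by lra.
have [n1 _ h1] := conv_distr_mean mXi cv (proj1 (test_fun_scale l l tp)) e3.
have [n2 _ h2] := conv_distr_mean mXi cv (proj1 (test_fun_scale m m tp)) e3.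
have mdev i : (1 <= i)%N -> forall B : set nat, measurable [set w | B (N i w)].
  move=> i1 B; rewrite (_ : [set w | _] = \bigcup_(k in B) [set w | N i w = k]).
    by apply: bigcup_measurable => k _; exact: mN.
  by apply/seteqP; split => w /= => [Bw|[k Bk ->]//]; exists (N i w).
have [n3 _ h3] : \forall i \near \oo, pr P [set w | t / 8 < `|(N i w)%:R / i%:R - 1|] <= e / 3.
  have /fine_cvgP[_ /cvgrPdist_le/(_ _ e3)] := cN _ t8.
  by apply: filterS => i; rewrite sub0r normrN ger0_norm ?pr_ge0.
pose n0 := maxn na (maxn nb (maxn n1 (maxn n2 (maxn n3 1)))).
have big i : (n0 <= i)%N -> [/\ (na <= i)%N, (nb <= i)%N, (n1 <= i)%N, (n2 <= i)%N
    & (n3 <= i)%N && (1 <= i)%N].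
  by rewrite /n0 !geq_max => /and5P[-> -> -> -> ->].
have dev i (B : set nat) : (n0 <= i)%N ->
    (forall k, B k -> t / 8 < `|k%:R / i%:R - 1|) -> pr P [set w | B (N i w)] <= e / 3.
  move=> /big[_ _ _ _ /andP[i3 i1]] hB; apply: le_trans (h3 i i3).
  apply: pr_le => [||w /hB//]; first exact: mdev.
  exact: (mdev i i1 [set k | t / 8 < `|k%:R / i%:R - 1|]).
have mXN i (f : mmspace R -> R) : (1 <= i)%N -> continuous01 f ->
    P.-integrable setT (EFin \o (fun w => f (X (N i w) w))).
  move=> i1 [fc f01]; apply: integrable01 => //.
  apply: (GHP_random_measurable _ fc); apply: GHP_random_index => //.
    by move=> k; exact: mN.
  by move=> w; exact: N1.
(* Beyond [4 / t], the rounding in [k] is harmless: [t n / 2 - 1] exceeds [t n / 4]. *)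
pose n4 := (Num.truncn (4 / t)).+1.
near=> n.
(* As [k] is at most [n / 2], this keeps [n - k] above [n0]. *)
have nn0 : (2 * n0 <= n)%N by near: n; exact: nbhs_infty_ge.
have nt : 4 < n%:R * t.
  rewrite -ltr_pdivrMr //; apply: lt_le_trans (truncnS_gt _) _.
  by rewrite ler_nat; near: n; exact: nbhs_infty_ge.
pose k := Num.truncn (t * n%:R / 2).
have tn0 : 0 <= t * n%:R / 2 by rewrite divr_ge0 // mulr_ge0 // ltW.
have k1 : k%:R <= t * n%:R / 2 by rewrite truncn_le.
have k2 : t * n%:R / 2 - 1 < k%:R by have := truncnS_gt (t * n%:R / 2); rewrite -natr1; lra.
have nR0 : 0 <= n%:R :> R by [].
have tn : t * n%:R <= n%:R by rewrite ler_piMl.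
have kn : (2 * k <= n)%N by rewrite -(ler_nat R) natrM; lra.
have n01 : (1 <= n0)%N by rewrite /n0 !leq_max leqnn !orbT.
have n_1 : (1 <= n)%N by clear -n01 nn0; lia.
have tn' : t * n%:R = n%:R * t by rewrite mulrC.
rewrite ler_distl; apply/andP; split.
(* Lower bound, from [N i] with [i] below [n]. The three thirds of [e] pay for [N i] exceeding [n],
   for the convergence along [i], and for the factor [m]. *)
- pose i := (n - k)%N; have ni : n = (i + k)%N by rewrite /i; clear -nn0 kn n01; lia.
  have [ia ib ii1 ii2 /andP[ii3 i1]] : _ := big i ltac:(rewrite /i; clear -nn0 kn n01; lia).
  have iR : n%:R = i%:R + k%:R :> R by rewrite -natrD -ni.
  have ki : k%:R <= t * i%:R.
    have : t * k%:R <= k%:R by rewrite ler_piMl.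
    have : t * n%:R = t * i%:R + t * k%:R by rewrite iR mulrDr.
    lra.
  have iR0 : 0 < i%:R :> R by rewrite ltr0n.
  have [_ an] := hta i k ia (le_trans ki (ler_wpM2r (ltW iR0) tta)).
  have [_ bn] := htb i k ib (le_trans ki (ler_wpM2r (ltW iR0) ttb)).
  have := h2 i ii2; rewrite /= ler_distl => /andP[+ _].
  have [_] := cmp n i _ n_1 i1 (test_fun_scale (a n) (b n) tp).
  have : pr P [set w | (n < N i w)%N] <= e / 3.
    apply: (dev i [set j | (n < j)%N]); first by rewrite /i; clear -nn0 kn n01; lia.
    move=> j /= nj; rewrite ltr_normr; apply/orP; left.
    rewrite ltrBrDr ltr_pdivlMr //; move: nj; rewrite -(ltr_nat R) iR mulrDl.
    have : t * i%:R <= t * n%:R by rewrite ler_pM2l // iR lerDl.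
    lra.
  have : \int[P]_w p (mmscale m m (mmscale (a i) (b i) (X (N i w) w))) <=
      \int[P]_w p (mmscale (a n) (b n) (X (N i w) w)).
    apply: le_Rintegral => //.
    + exact: (mXN i _ i1 (proj1 (test_fun_scale (a i) (b i) (test_fun_scale m m tp)))).
    + exact: (mXN i _ i1 (proj1 (test_fun_scale (a n) (b n) tp))).
    + move=> w _; apply/pm/mm_le_scale2'.
        by have := ler_wpM2l (ltW m0) an; rewrite -ni mulrA ml mul1r.
      by have := ler_wpM2l (ltW m0) bn; rewrite -ni mulrA ml mul1r.
  lra.
(* Upper bound, symmetric, with [i] above [n] and the factor [l]. *)
- pose i := (n + k)%N.
  have [ia ib ii1 ii2 /andP[ii3 i1]] : _ := big i ltac:(rewrite /i; clear -nn0 kn n01; lia).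
  have iR : i%:R = n%:R + k%:R :> R by rewrite -natrD.
  have kt : k%:R <= t * n%:R by lra.
  have iR0 : 0 < i%:R :> R by rewrite ltr0n.
  have [na' nb' _ _ _] : _ := big n ltac:(clear -nn0; lia).
  have [_ an] := hta n k na' (le_trans kt (ler_wpM2r nR0 tta)).
  have [_ bn] := htb n k nb' (le_trans kt (ler_wpM2r nR0 ttb)).
  have := h1 i ii1; rewrite /= ler_distl => /andP[_].
  have [+ _] := cmp n i _ n_1 i1 (test_fun_scale (a n) (b n) tp).
  have : pr P [set w | (N i w < n)%N] <= e / 3.
    apply: (dev i [set j | (j < n)%N]); first by rewrite /i; clear -nn0 kn n01; lia.
    move=> j /= nj; rewrite ltr_normr; apply/orP; right.
    rewrite opprB ltrBrDl -ltrBrDr ltr_pdivrMr //; move: nj.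
    rewrite -(ltr_nat R) iR mulrBl mul1r mulrDr.
    have : t * k%:R <= k%:R by rewrite ler_piMl.
    lra.
  have : \int[P]_w p (mmscale (a n) (b n) (X (N i w) w)) <=
      \int[P]_w p (mmscale l l (mmscale (a i) (b i) (X (N i w) w))).
    apply: le_Rintegral => //.
    + exact: (mXN i _ i1 (proj1 (test_fun_scale (a n) (b n) tp))).
    + exact: (mXN i _ i1 (proj1 (test_fun_scale (a i) (b i) (test_fun_scale l l tp)))).
    + by move=> w _; apply/pm/mm_le_scale2.
  lra.
Unshelve. all: by end_near.
Qed.

(** * From increasing functions to weak convergence *)

Definition bump (R : realType) (ul : (mmspace R -> R) * (mmspace R -> R))
  (X : mmspace R) : R := ul.1 X * (1 - ul.2 X).

Definition cover_fun (R : realType) (s : seq ((mmspace R -> R) * (mmspace R -> R)))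
  (X : mmspace R) : R := \prod_(ul <- s) (1 - bump ul X).

Lemma continuous01_bump (R : realType) (ul : (mmspace R -> R) * (mmspace R -> R)) :
  test_fun ul.1 -> test_fun ul.2 -> continuous01 (bump ul).
Proof. by move=> [h1 _] [h2 _]; apply/continuous01_mul/continuous01_onem. Qed.

Lemma continuous01_cover (R : realType) (s : seq ((mmspace R -> R) * (mmspace R -> R))) :
  (forall ul, List.In ul s -> test_fun ul.1 /\ test_fun ul.2) ->
  continuous01 (cover_fun s).
Proof.
elim: s => [|ul s IH] hs.
  split=> [X e e0|X]; last by rewrite /cover_fun big_nil ler01 lexx.
  by exists 1 => // Y _; rewrite /cover_fun !big_nil subrr normr0.
rewrite (_ : cover_fun _ = fun X => (1 - bump ul X) * cover_fun s X); last first.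
  by apply/funext => X; rewrite /cover_fun big_cons.
have [h1 h2] := hs ul (or_introl erefl).
apply: continuous01_mul; first exact/continuous01_onem/continuous01_bump.
by apply: IH => v vs; apply: hs; right.
Qed.

(* [p (1 - u (1 - l)) = p - p u + p u l]: products of test functions being test
   functions, convergence on these propagates to [p] times a product of bumps. *)
Lemma mean_cover_cvg (R : realType) (dO : measure_display) (Omega : measurableType dO)
  (P : probability Omega R) (Y : nat -> Omega -> mmspace R) (Yinf : Omega -> mmspace R)
  (s : seq ((mmspace R -> R) * (mmspace R -> R))) :
  (forall n f, (1 <= n)%N -> GHP_continuous f -> measurable_fun setT (fun w => f (Y n w))) ->
  GHP_random Yinf ->
  (forall p (e : R), test_fun p -> 0 < e -> \forall n \near \oo,
     `|\int[P]_w p (Y n w) - \int[P]_w p (Yinf w)| <= e) ->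
  (forall ul, List.In ul s -> test_fun ul.1 /\ test_fun ul.2) ->
  forall p (e : R), test_fun p -> 0 < e -> \forall n \near \oo,
    `|\int[P]_w (p (Y n w) * cover_fun s (Y n w))
      - \int[P]_w (p (Yinf w) * cover_fun s (Yinf w))| <= e.
Proof.
(* The induction must hold for all [p] at once: it is used at [p], [p u] and [p u l]. *)
move=> mY mYi cv; elim: s => [|ul s IH] hs p e tp e0.
  have simp Z : \int[P]_w (p (Z w) * cover_fun [::] (Z w)) = \int[P]_w p (Z w).
    by apply: eq_Rintegral => w _; rewrite /cover_fun big_nil mulr1.
  by have := cv p e tp e0; apply: filterS => n; rewrite !simp.
have [tu tl] := hs ul (or_introl erefl).
have hs' ul' : List.In ul' s -> test_fun ul'.1 /\ test_fun ul'.2.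
  by move=> h; apply: hs; right.
have e3 : 0 < e / 3 by lra.
have tpu := test_fun_mul tp tu; have tpul := test_fun_mul tpu tl.
have cs := continuous01_cover hs'.
have int (f : mmspace R -> R) (Z : Omega -> mmspace R) :
    (forall g, GHP_continuous g -> measurable_fun setT (fun w => g (Z w))) ->
    test_fun f ->
    P.-integrable setT (EFin \o (fun w => f (Z w) * cover_fun s (Z w))).
  move=> mZ [cf _]; have [fc f01] := continuous01_mul cf cs.
  by apply: integrable01 (mZ _ fc) _ => w; exact: f01.
have split3 (Z : Omega -> mmspace R) :
    (forall g, GHP_continuous g -> measurable_fun setT (fun w => g (Z w))) ->
    \int[P]_w (p (Z w) * cover_fun (ul :: s) (Z w)) =
    \int[P]_w (p (Z w) * cover_fun s (Z w)) -
    \int[P]_w (p (Z w) * ul.1 (Z w) * cover_fun s (Z w)) +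
    \int[P]_w (p (Z w) * ul.1 (Z w) * ul.2 (Z w) * cover_fun s (Z w)).
  move=> mZ; have i1 := int _ _ mZ tp; have i2 := int _ _ mZ tpu.
  have i3 := int _ _ mZ tpul; have i12 := integrableB measurableT i1 i2.
  rewrite -RintegralB // -RintegralD //; apply: eq_Rintegral => w _.
  by rewrite /cover_fun big_cons /bump; ring.
near=> n; have n1 : (1 <= n)%N by near: n; exact: nbhs_infty_ge.
rewrite (split3 _ (fun g => mY n g n1)).
rewrite (split3 _ (fun g gc => GHP_random_measurable mYi gc)).
have : `|\int[P]_w (p (Y n w) * cover_fun s (Y n w))
      - \int[P]_w (p (Yinf w) * cover_fun s (Yinf w))| <= e / 3.
  by near: n; exact: IH.
have : `|\int[P]_w (p (Y n w) * ul.1 (Y n w) * cover_fun s (Y n w))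
      - \int[P]_w (p (Yinf w) * ul.1 (Yinf w) * cover_fun s (Yinf w))| <= e / 3.
  by near: n; exact: (IH hs' _ _ tpu e3).
have : `|\int[P]_w (p (Y n w) * ul.1 (Y n w) * ul.2 (Y n w) * cover_fun s (Y n w))
      - \int[P]_w (p (Yinf w) * ul.1 (Yinf w) * ul.2 (Yinf w) * cover_fun s (Yinf w))| <= e / 3.
  by near: n; exact: (IH hs' _ _ tpul e3).
rewrite !ler_norml => /andP[? ?] /andP[? ?] /andP[? ?]; apply/andP; split; lra.
Unshelve. all: by end_near.
Qed.

(** Among the countably many bumps around the centres of all scales, those vanishing off [G] are
    kept. They suffice because every point of [G] has a centre so near that its bump lives inside
    [G]. *)
Lemma open_bumps (R : realType) (X0 : mmspace R) (G : set (mmspace R)) : GHPopen G ->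
  exists ul : nat -> (mmspace R -> R) * (mmspace R -> R),
    [/\ forall i, test_fun (ul i).1 /\ test_fun (ul i).2,
        forall i X, ~ G X -> bump (ul i) X = 0 &
        forall X, G X -> exists i, bump (ul i) X = 1].
Proof.
move=> oG; have [W hW] := ghp_code_centers X0.
pose s j : R := 5 * j.+1%:R^-1.
have s0 j : 0 < s j by rewrite /s mulr_gt0 // invr_gt0.
pose box (jk : nat * nat) : (mmspace R -> R) * (mmspace R -> R) :=
  (fun X => ramp (domq X (W jk.1 jk.2) / s jk.1),
   fun X => 1 - ramp (domq (W jk.1 jk.2) X / s jk.1)).
have tz : test_fun (fun _ : mmspace R => 0).
  split; last by move=> *; exact: lexx.
  split=> [X e e0|X]; last by rewrite lexx ler01.
  by exists 1 => // Y _; rewrite subrr normr0.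
(* Rejected or meaningless indices receive the zero pair, whose bump is 0. *)
pose ul i := if unpickle i is Some jk then
    if `[< forall X, ~ G X -> bump (box jk) X = 0 >] then box jk
    else (fun=> 0, fun=> 0)
  else (fun=> 0, fun=> 0).
exists ul; split.
- move=> i; rewrite /ul; case: (unpickle i) => [[j k]|]; last by split.
  case: ifP => _; last by split.
  by split; [exact: test_fun_up|exact: test_fun_down].
- move=> i X nGX; rewrite /ul; case: (unpickle i) => [jk|]; last by rewrite /bump mul0r.
  by case: asboolP => [h|_]; [exact: h|rewrite /bump mul0r].
- move=> X GX; have [e e0 he] := oG X GX; have [r r0 hr] := dom_antisym X e0.
  (* Since [3 * s j] is [15 / (j + 1)], this index is fine enough for [3 * s j < r]. *)
  pose j := Num.truncn (15 / r).
  have sj : 3 * s j < r.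
    have := truncnS_gt (15 / r); rewrite -/j ltr_pdivrMr // => hj.
    rewrite /s mulrA -(@ltr_pM2r _ j.+1%:R) ?ltr0n // mulfVK ?gt_eqF ?ltr0n //.
    by rewrite [r * _]mulrC; apply: le_lt_trans hj; lra.
  have [k [k1 k2]] : exists k, domq X (W j k) <= s j /\ domq (W j k) X <= s j := hW j X.
  exists (pickle (j, k)).
  rewrite /ul pickleK; case: asboolP => [_|]; last first.
    (* Where the bump is nonzero, [Z] is within [2 * s j] of the centre in both directions and [X]
       within [s j]. So [X] and [Z] dominate each other up to [r], and [Z] would lie in [G]. *)
    case=> Z nGZ; apply/eqP; apply: contrapT => /negP bZ; apply: nGZ.
    have /andP[u0 u1] := ramp01 (domq Z (W j k) / s j).
    have /andP[l0 l1] := ramp01 (domq (W j k) Z / s j).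
    move: bZ; rewrite /bump /= subKr mulf_eq0 negb_or => /andP[uZ lZ].
    have {uZ}/ramp_gt0 : 0 < ramp (domq Z (W j k) / s j) by rewrite lt_def uZ.
    have {lZ}/ramp_gt0 : 0 < ramp (domq (W j k) Z / s j) by rewrite lt_def lZ.
    rewrite !ltr_pdivrMr // => h1 h2; apply/he/hr; apply: domq_lt.
      by have := domq_trans X (W j k) Z; lra.
    by have := domq_trans Z (W j k) X; lra.
  rewrite /bump /= subKr !ramp1 ?mulr1 // ler_pdivrMr // mul1r //.
Qed.

Lemma mean_indic (R : realType) (dO : measure_display) (Omega : measurableType dO)
  (P : probability Omega R) (A : set Omega) : measurable A ->
  \int[P]_w \1_A w = pr P A.
Proof.
by move=> mA; rewrite /Rintegral integral_indic // setIT.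
Qed.

(** The functions [cover_fun (s m)] lie above the indicator of the complement of [G] and tend to it
    pointwise. Convergence of their means bounds the probability of the complement from above, that
    is, the probability of [G] from below. *)
Lemma pr_open_liminf (R : realType) (dO : measure_display) (Omega : measurableType dO)
  (P : probability Omega R) (Y : nat -> Omega -> mmspace R) (Yinf : Omega -> mmspace R)
  (G : set (mmspace R)) (e : R) :
  (forall n, (1 <= n)%N -> GHP_random (Y n)) -> GHP_random Yinf ->
  (forall p (e : R), test_fun p -> 0 < e -> \forall n \near \oo,
     `|\int[P]_w p (Y n w) - \int[P]_w p (Yinf w)| <= e) ->
  GHPopen G -> 0 < e ->
  \forall n \near \oo, pr P (Yinf @^-1` G) <= pr P (Y n @^-1` G) + e.
Proof.
move=> mY mYi cv oG e0; have e2 : 0 < e / 2 by lra.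
have bG : GHPborel G by exact: sub_gen_smallest.
have bC := GHPborelC bG.
(* [Omega] is nonempty as it has mass 1; this supplies the default space required by
   [open_bumps]. *)
have [w0 _] : [set: Omega] !=set0.
  apply/set0P; apply/eqP => T0; have := probability_setT P.
  by rewrite T0 measure0 => -[] /esym/eqP; rewrite oner_eq0.
have [ul [tul ul0 ul1]] := open_bumps (Yinf w0) oG.
pose s m := [seq ul i | i <- iota 0 m].
have ts m v : List.In v (s m) -> test_fun v.1 /\ test_fun v.2.
  rewrite /s; elim: (iota 0 m) => //= i r IH [<-|/IH//]; exact: tul.
have cs m := continuous01_cover (ts m).
have off m Z : ~ G Z -> cover_fun (s m) Z = 1.
  move=> nG; rewrite /cover_fun big_map big1 // => i _.
  by rewrite ul0 // subr0.
have lim Z : (fun m => (cover_fun (s m) Z)%:E) @ \oo --> (\1_(~` G) Z : R)%:E.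
  have [GZ|nG] := pselect (G Z); last first.
    rewrite indicE mem_set //; apply: cvg_near_cst; exact: nearW (fun m => congr1 EFin (off m Z nG)).
  rewrite indicE memNset; last by move=> /(_ GZ).
  have [i hi] := ul1 Z GZ; apply: cvg_near_cst; exists i.+1 => // m /= im.
  congr EFin; rewrite /cover_fun big_map (bigD1_seq i) ?iota_uniq ?mem_iota //=.
  by rewrite hi subrr mul0r.
have mcov Z m : GHP_random Z -> measurable_fun setT (fun w : Omega => cover_fun (s m) (Z w)).
  by move=> mZ; apply: GHP_random_measurable mZ _; case: (cs m).
have mind Z : GHP_random Z -> measurable_fun setT (fun w : Omega => \1_(~` G) (Z w) : R).
  move=> mZ; exact: (measurable_indic (mZ _ bC)).
(* The number [m] of bumps is fixed using the law of [Yinf] alone, before [n] grows. *)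
have [m hm] : exists m, \int[P]_w cover_fun (s m) (Yinf w) <=
    pr P (Yinf @^-1` (~` G)) + e / 2.
  have [|||||_ _] := @dominated_convergence _ _ _ P _ measurableT
    (fun m w => (cover_fun (s m) (Yinf w))%:E) (fun w => (\1_(~` G) (Yinf w))%:E)
    (fun=> 1%E).
  - by move=> m; apply/measurable_EFinP; exact: mcov.
  - by apply/measurable_EFinP; exact: mind.
  - by apply: aeW => w _; exact: lim.
  - by apply: integrable01 => // w; rewrite ler01 lexx.
  - apply: aeW => w m _; rewrite /= lee_fin.
    by have [_ /(_ (Yinf w))/andP[? ?]] := cs m; rewrite ger0_norm.
  rewrite (_ : (\int[P]_w _)%E = (pr P (Yinf @^-1` (~` G)))%:E); last first.
    rewrite EFin_pr; last exact: mYi bC.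
    exact: etrans (integral_indic P measurableT (mYi _ bC)) (congr1 P (setIT _)).
  move=> /fine_cvgP[_ /cvgrPdist_le/(_ _ e2)[m _ /(_ m (leqnn m))]].
  by rewrite /= ler_distlC => /andP[_ ?]; exists m.
have t1 : test_fun (fun _ : mmspace R => 1).
  split; last by move=> *; exact: lexx.
  split=> [X x x0|X]; last by rewrite ler01 lexx.
  by exists 1 => // Z _; rewrite subrr normr0.
near=> n; have n1 : (1 <= n)%N by near: n; exact: nbhs_infty_ge.
have : `|\int[P]_w (1 * cover_fun (s m) (Y n w))
      - \int[P]_w (1 * cover_fun (s m) (Yinf w))| <= e / 2.
  near: n; apply: (mean_cover_cvg _ mYi cv (ts m) t1 e2) => n f n1.
  exact: GHP_random_measurable (mY n n1).
under [X in _ - X]eq_Rintegral do rewrite mul1r.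
under eq_Rintegral do rewrite mul1r.
rewrite ler_distl => /andP[_ h].
have : pr P (Y n @^-1` (~` G)) <= \int[P]_w cover_fun (s m) (Y n w).
  rewrite -mean_indic; last exact: (mY n n1 _ bC).
  apply: le_Rintegral => //.
  - apply: integrable01 => [|w]; first exact: (mind _ (mY n n1)).
    by rewrite indicE ler0n lern1 leq_b1.
  - apply: integrable01 => [|w]; first exact: (mcov _ _ (mY n n1)).
    by have [_] := cs m.
  - move=> w _; rewrite indicE; case: (pselect (G (Y n w))) => hG.
      rewrite memNset; last by move=> /(_ hG).
      by have [_ /(_ (Y n w))/andP[]] := cs m.
    by rewrite off // lern1 leq_b1.
move=> /le_trans/(_ h) h'.
have {h' hm} := le_trans h' (lerD hm (lexx (e / 2))).
have -> : pr P (Y n @^-1` (~` G)) = 1 - pr P (Y n @^-1` G) := prC P (mY n n1 _ bG).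
have -> : pr P (Yinf @^-1` (~` G)) = 1 - pr P (Yinf @^-1` G) := prC P (mYi _ bG).
move: (pr P (Y n @^-1` G)) (pr P (Yinf @^-1` G)) => x y; lra.
Unshelve. all: by end_near.
Qed.

Lemma mean_continuous_liminf (R : realType) (dO : measure_display)
  (Omega : measurableType dO) (P : probability Omega R)
  (Y : nat -> Omega -> mmspace R) (Yinf : Omega -> mmspace R)
  (f : mmspace R -> R) (e : R) :
  (forall n, (1 <= n)%N -> GHP_random (Y n)) -> GHP_random Yinf ->
  (forall p (e : R), test_fun p -> 0 < e -> \forall n \near \oo,
     `|\int[P]_w p (Y n w) - \int[P]_w p (Yinf w)| <= e) ->
  continuous01 f -> 0 < e ->
  \forall n \near \oo, \int[P]_w f (Yinf w) <= \int[P]_w f (Y n w) + e.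
Proof.
move=> mY mYi cv [fc f01] e0.
apply: (@mean_liminf_tail _ _ _ P (fun n w => f (Y n w)) (fun w => f (Yinf w))) => //.
- by exists 1%N => // n n1; exact: GHP_random_measurable (mY n n1) fc.
- exact: GHP_random_measurable mYi fc.
- by move=> t x; exact: (pr_open_liminf mY mYi cv (GHP_open_gt (c := t) fc)).
Qed.

(** An affine change turns [f] into a function [g] with values in [0,1]; the lower bounds for [g]
    and for [1 - g] together give convergence of the means. *)
Lemma mean_continuous_cvg (R : realType) (dO : measure_display)
  (Omega : measurableType dO) (P : probability Omega R)
  (Y : nat -> Omega -> mmspace R) (Yinf : Omega -> mmspace R) :
  (forall n, (1 <= n)%N -> GHP_random (Y n)) -> GHP_random Yinf ->
  (forall p (e : R), test_fun p -> 0 < e -> \forall n \near \oo,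
     `|\int[P]_w p (Y n w) - \int[P]_w p (Yinf w)| <= e) ->
  conv_distr P Y Yinf.
Proof.
move=> mY mYi cv f [M hM] fc.
pose K := `|M| + 1; have K0 : 0 < K by rewrite /K ltr_wpDl.
have hK Z : `|f Z| <= K.
  by apply: le_trans (hM Z) _; apply: le_trans (ler_norm M) _; rewrite /K lerDl.
pose g Z := (f Z + K) / (2 * K).
have K2 : 0 < 2 * K by rewrite mulr_gt0.
have g01 : continuous01 g.
  split=> [X e e0|X]; last first.
    have := hK X; rewrite ler_norml => /andP[h1 h2].
    rewrite /g divr_ge0 ?(ltW K2) //=; last lra.
    by rewrite ler_pdivrMr // mul1r; lra.
  have [t t0 ht] := fc X (e * (2 * K)) (mulr_gt0 e0 K2); exists t => // Z /ht h.
  rewrite /g -mulrBl normrM [`|_^-1|]gtr0_norm ?invr_gt0 // ltr_pdivrMr //.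
  by rewrite (_ : f X + K - (f Z + K) = f X - f Z) //; ring.
have fE Z : f Z = 2 * K * g Z - K by rewrite /g mulrC divfK ?gt_eqF // addrK.
have ig (Z : Omega -> mmspace R) (h : mmspace R -> R) : GHP_random Z ->
    continuous01 h -> P.-integrable setT (EFin \o (fun w => h (Z w))).
  move=> mZ [hc h01]; apply: integrable01 => //; exact: GHP_random_measurable.
have i1 : P.-integrable setT (EFin \o (fun=> 1 : R)).
  by apply: integrable01 => // w; rewrite ler01 lexx.
have iK : P.-integrable setT (EFin \o (fun=> K)).
  by apply: (integrable_bdd P (M := K)) => // w; rewrite gtr0_norm.
have if_ (Z : Omega -> mmspace R) : GHP_random Z ->
    P.-integrable setT (EFin \o (fun w => f (Z w))).
  move=> mZ; apply: (integrable_bdd P (M := K)) => [|w]; last exact: hK.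
  exact: GHP_random_measurable.
have P1 : fine (P setT) = 1 by rewrite probability_setT.
have meanf (Z : Omega -> mmspace R) : GHP_random Z ->
    \int[P]_w f (Z w) = 2 * K * \int[P]_w g (Z w) - K.
  move=> mZ; have igZ := ig _ _ mZ g01.
  have iKg : P.-integrable setT (EFin \o (fun w => 2 * K * g (Z w))).
    by have := integrableZl measurableT (2 * K) igZ.
  under eq_Rintegral do rewrite fE.
  rewrite RintegralB // RintegralZl // Rintegral_cst //.
  by congr (_ - _); rewrite -[RHS]mulr1; congr (_ * _); exact: P1.
rewrite EFin_mean; last exact: if_.
apply: cvg_EFin.
  by exists 1%N => // n n1; apply: integrable_fin_num => //; exact: (if_ _ (mY n n1)).
apply/cvgrPdist_le => e e0; have eK : 0 < e / (2 * K) by rewrite divr_gt0.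
have mono1 (Z : Omega -> mmspace R) : GHP_random Z ->
    \int[P]_w (1 - g (Z w)) = 1 - \int[P]_w g (Z w).
  move=> mZ; rewrite RintegralB //; last exact: ig.
  by rewrite Rintegral_cst // mul1r; congr (_ - _); exact: P1.
near=> n; have n1 : (1 <= n)%N by near: n; exact: nbhs_infty_ge.
have h1 : \int[P]_w g (Yinf w) <= \int[P]_w g (Y n w) + e / (2 * K).
  by near: n; exact: mean_continuous_liminf.
have h2 : \int[P]_w (1 - g (Yinf w)) <= \int[P]_w (1 - g (Y n w)) + e / (2 * K).
  by near: n; exact: (mean_continuous_liminf mY mYi cv (continuous01_onem g01)).
change (`|\int[P]_w f (Yinf w) - \int[P]_w f (Y n w)| <= e).
rewrite (meanf _ mYi) (meanf _ (mY n n1)).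
move: h2; rewrite (mono1 _ mYi) (mono1 _ (mY n n1)) => h2.
rewrite opprB addrA subrK -mulrBr normrM (gtr0_norm K2) mulrC -ler_pdivlMr //.
by rewrite ler_distl; apply/andP; split; lra.
Unshelve. all: by end_near.
Qed.

Theorem theorem1p4 (R : realType) (dO : measure_display) (Omega : measurableType dO)
  (P : probability Omega R)
  (X : nat -> Omega -> mmspace R) (Xinf : Omega -> mmspace R)
  (N : nat -> Omega -> nat) (a b : nat -> {posnum R}) :
  (forall n, (1 <= n)%N -> GHP_random (X n)) ->
  GHP_random Xinf ->
  (forall n k, (1 <= n)%N -> measurable [set w | N n w = k]) ->
  (forall n w, (1 <= n)%N -> (1 <= N n w)%N) ->
  tame (fun n => (a n)%:num) ->
  tame (fun n => (b n)%:num) ->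
  indep_sigma P (sigma_nat N) (sigma_GHP X Xinf) ->
  conv_distr P (fun n w => mmscale (a n) (b n) (X (N n w) w)) Xinf ->
  (forall e : R, 0 < e ->
     P [set w | e < `|(N n w)%:R / n%:R - 1|] @[n --> \oo] --> 0%E) ->
  (forall n, (1 <= n)%N -> stoch_le P (X n) (X n.+1)) ->
  conv_distr P (fun n w => mmscale (a n) (b n) (X n w)) Xinf.
Proof.
move=> mX mXi mN N1 ta tb ind cv cN st.
apply: mean_continuous_cvg => //.
  by move=> n n1 B hB; exact: (mX n n1 _ (GHPborel_scale (a n) (b n) hB)).
move=> p e tp e0; apply: (mean_test_cvg mX mXi mN N1 ta tb _ cv cN tp e0).
move=> n m q n1 m1 tq; apply: (@random_index_compare _ _ _ P X (N m) n q) => //.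
- by move=> k; exact: mN.
- by move=> w; exact: N1.
- move=> k B k1 hB; apply: ind.
    by apply: sub_gen_smallest; exists m, [set k].
  by apply: sub_gen_smallest; left; exists k, B.
- move=> k l k1 kl A bA iA; rewrite -(subnKC kl); elim: (l - k)%N => [|d IH].
    by rewrite addn0.
  by rewrite addnS; apply: le_trans IH _; apply: st => //; exact: ltn_addr.
Qed.
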